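(* (Improved Buchberger Procedure.) Let $s\ge1$ and let $G=\{g_1,\dots,g_s\}\subseteq K\langle X\rangle$ be a set of non-zero polynomials which generate a two-sided ideal $I=\langle G\rangle\subseteq K\langle X\rangle$. Consider the following sequence of instructions. (B1) Let $B=\bigcup_{1\le i\le j\le s}{\rm NTObs}(i,j)$. (B2) If $B=\emptyset$, return the result $G$. Otherwise, select an obstruction ${\rm o}_{i,j}(w_i,w'_i;w_j,w'_j)\in B$ using a fair strategy and delete it from $B$. (B3) Compute the S-polynomial $S=S_{i,j}(w_i,w'_i;w_j,w'_j)$ and its normal remainder $S'={\rm NR}_{\sigma,G}(S)$. If $S'=0$, continue with step (B2). (4a) Increase $s$ by one. Append $g_s=S'$ to the set $G$, and form the set of non-trivial obstructions ${\rm NTObs}(s)=\bigcup_{1\le i\le s}{\rm NTObs}(i,s)$. (4b) Remove from ${\rm NTObs}(s)$ all obstructions ${\rm o}_{i,s}(w_i,w'_i;u_s,u'_s)$ such that there exists an obstruction ${\rm o}_{j,s}(w_j,w'_j;v_s,v'_s)\in{\rm NTObs}(s)$ with the property that there exist two words $w,w'\in\langle X\rangle$ satisfying $u_s=wv_s$, $u'_s=v'_sw'$ and $ww'\ne1$. (4c) Remove from ${\rm NTObs}(s)$ all obstructions ${\rm o}_{i,s}(w_i,w'_i;u_s,u'_s)$ such that there exists an obstruction ${\rm o}_{j,s}(w_j,w'_j;v_s,v'_s)\in{\rm NTObs}(s)$ with the property that there exist two words $w,w'\in\langle X\rangle$ satisfying $u_s=wv_s$, $u'_s=v'_sw'$,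 and such that $i>j$, or $i=j$ and $ww'=1$ and $w_i>_\sigma w_j$. (4d) Remove from $B$ all obstructions ${\rm o}_{i,j}(w_i,w'_i;w_j,w'_j)$ such that there exist two words $w,w'\in\langle X\rangle$ satisfying $w\,{\rm Lw}_\sigma(g_s)w'=w_j{\rm Lw}_\sigma(g_j)w'_j$, and such that the following conditions are satisfied: (i) the obstruction ${\rm o}_{i,s}(w_i,w'_i;w,w')$ is either an obstruction without overlap or a (proper or improper) multiple of a non-trivial obstruction in ${\rm NTObs}(s)$; (ii) the obstruction ${\rm o}_{j,s}(w_j,w'_j;w,w')$ is either an obstruction without overlap or a (proper or improper) multiple of a non-trivial obstruction in ${\rm NTObs}(s)$. (4e) Replace $B$ by $B\cup{\rm NTObs}(s)$ and continue with step (B2). Then this sequence of instructions is a procedure that enumerates a $\sigma$-Gröbner basis $G$ of $I$. If $I$ has a finite $\sigma$-Gröbner basis, it stops after finitely many steps and the resulting set $G$ is a finite $\sigma$-Gröbner basis of $I$.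
   Context: Basic notation. $K$ is a field, $X=\{x_1,\dots,x_n\}$ a finite alphabet, $\langle X\rangle$ the monoid of words in $X$ (product is concatenation, empty word is $1$), and $K\langle X\rangle$ the free associative $K$-algebra. A word ordering is a (total) well-ordering $\sigma$ on $\langle X\rangle$ such that $w_1\ge_\sigma w_2$ implies $w_3w_1w_4\ge_\sigma w_3w_2w_4$ for all words; $\sigma$ is a fixed word ordering. For $f\ne0$, ${\rm Lw}_\sigma(f)$ is the $\sigma$-largest word in the support of $f$ and ${\rm Lc}_\sigma(f)$ its coefficient. A subset $G$ of a two-sided ideal $I$ is a $\sigma$-Gröbner basis of $I$ if $\{{\rm Lw}_\sigma(g)\mid g\in G\setminus\{0\}\}$ generates the two-sided ideal $\langle {\rm Lw}_\sigma(f)\mid f\in I\setminus\{0\}\rangle$. Obstructions. For $G=\{g_1,\dots,g_s\}\subseteq K\langle X\rangle\setminus\{0\}$ let $F_s=(K\langle X\rangle\otimes_KK\langle X\rangle)^s$ be the free two-sided module with canonical basis $e_1,\dots,e_s$. If words satisfy $w_i{\rm Lw}_\sigma(g_i)w'_i=w_j{\rm Lw}_\sigma(g_j)w'_j$, then ${\rm o}_{i,j}(w_i,w'_i;w_j,w'_j)=\frac1{{\rm Lc}_\sigma(g_i)}w_ie_iw'_i-\frac1{{\rm Lc}_\sigma(g_j)}w_je_jw'_j\in F_s$, whenever non-zero, is called an obstruction of $g_i$ and $g_j$; its S-polynomial is $S_{i,j}(w_i,w'_i;w_j,w'_j)=\frac1{{\rm Lc}_\sigma(g_i)}w_ig_iw'_i-\frac1{{\rm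 Lc}_\sigma(g_j)}w_jg_jw'_j$. A multiple of this obstruction is an obstruction ${\rm o}_{i,j}(ww_i,w'_iw';ww_j,w'_jw')$ with $w,w'\in\langle X\rangle$; the multiple is proper if $ww'\neq1$. The obstruction has an overlap if the indicated occurrences of ${\rm Lw}_\sigma(g_i)$ and ${\rm Lw}_\sigma(g_j)$ in the word $w_i{\rm Lw}_\sigma(g_i)w'_i=w_j{\rm Lw}_\sigma(g_j)w'_j$ overlap in a non-empty word (share a letter position); otherwise it has no overlap. For $i\ne j$, an obstruction of $g_i,g_j$ is non-trivial if it has an overlap and is of one of the forms ${\rm o}_{i,j}(w_i,1;1,w'_j)$, ${\rm o}_{i,j}(1,w'_i;w_j,1)$, ${\rm o}_{i,j}(w_i,w'_i;1,1)$, ${\rm o}_{i,j}(1,1;w_j,w'_j)$; an obstruction of $g_i$ with itself is non-trivial if it has an overlap and is of the form ${\rm o}_{i,i}(1,w'_i;w_i,1)$ with $w_i,w'_i\ne1$. ${\rm NTObs}(i,j)$ is the set of non-trivial obstructions of $g_i$ and $g_j$. Normal remainder. ${\rm NR}_{\sigma,G}(f)$ is any polynomial $p$ produced by the division algorithm: start with $p=0$, $v=f$; while $v\ne0$: if ${\rm Lw}_\sigma(v)=w\,{\rm Lw}_\sigma(g_i)w'$ for some $i$ (take the smallest such $i$) and words $w,w'$, replace $v$ by $v-\frac{{\rm Lc}_\sigma(v)}{{\rm Lc}_\sigma(g_i)}wg_iw'$; otherwise move the leading monomial of $v$ from $v$ to $p$. Conventions for the procedure. $G$, $s$, $B$ and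 ${\rm NTObs}(s)$ are program variables whose current contents are used in each step (in particular, in (4d) and (4e), ${\rm NTObs}(s)$ is the set left after the removals in (4b) and (4c)). A fair strategy is a selection strategy which ensures that every obstruction (that is not removed from $B$ beforehand) is selected eventually. The procedure ''enumerates a $\sigma$-Gröbner basis of $I$'' if the set of all polynomials which are in $G$ at some stage is a $\sigma$-Gröbner basis of $I$. *)

(* Defs.v *)
From mathcomp Require Import all_boot all_algebra finmap.
From mathcomp.multinomials Require Export monalg.

Set Implicit Arguments.
Unset Strict Implicit.
Unset Printing Implicit Defensive.

Import GRing.Theory.
Local Open Scope ring_scope.

Local Notation "1" := (@mone _) : monom_scope.
Local Notation "x * y" := (mmul x y) : monom_scope.

(** The free monoid <X> is [{fmonom X}] (product [( _ * _ )%M], empty word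
    [1%M]) and the free associative algebra K<X> is [{malg K[{fmonom X}]}]. *)

(** [sigma u v] reads: u is less than or equal to v. *)
Record word_ordering (X : finType) (sigma : rel {fmonom X}) : Prop := {
  word_ordering_total : total sigma;
  word_ordering_anti : antisymmetric sigma;
  word_ordering_trans : transitive sigma;
  word_ordering_wf :
    well_founded (fun u v : {fmonom X} => sigma u v /\ u <> v);
  word_ordering_mul : forall a u v b : {fmonom X},
    sigma u v -> sigma (a * u * b)%M (a * v * b)%M
}.

Section Ideals.
Variable A : nzRingType.

Definition two_sided_ideal (J : A -> Prop) : Prop :=
  [/\ J 0, forall f g, J f -> J g -> J (f + g)
    & forall a f b, J f -> J (a * f * b)].

Definition ideal_gen (P : A -> Prop) (f : A) : Prop :=
  forall J, two_sided_ideal J -> (forall g, P g -> J g) -> J f.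

End Ideals.

Section Procedure.
Variables (K : fieldType) (X : finType) (sigma : rel {fmonom X}).

Local Notation word := {fmonom X}.
Local Notation alg := {malg K[{fmonom X}]}.

Implicit Types (f g v p r : alg) (w u a b : word) (G : seq alg).

(** Leading word (the conventional value at [f = 0] is [1%M]) and leading
    coefficient. *)
Definition Lw f : word := last 1%M (sort sigma (msupp f)).
Definition Lc f : K := f@_(Lw f).

Definition sandwich w f u : alg := << w >> * f * << u >>.

Definition word_divides u w : Prop := exists a b, w = (a * u * b)%M.

Definition lead_words (P : alg -> Prop) (h : alg) : Prop :=
  exists g, [/\ P g, g <> 0 & h = << Lw g >>].

Definition is_groebner_basis (P I : alg -> Prop) : Prop :=
  (forall g, P g -> I g) /\
  (forall h, ideal_gen (lead_words P) h <-> ideal_gen (lead_words I) h).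

(** [division G p v r]: the division algorithm with divisors [G], run from
    the values [p] and [v] of its variables, can end with the result [r]. *)
Inductive division G : alg -> alg -> alg -> Prop :=
| division_end p : division G p 0 p
| division_reduce p v i w u r :
    v <> 0 -> (i < size G)%N ->
    Lw v = (w * Lw G`_i * u)%M ->
    (forall k, (k < i)%N -> ~ word_divides (Lw G`_k) (Lw v)) ->
    division G p (v - (Lc v / Lc G`_i) *: sandwich w G`_i u) r ->
    division G p v r
| division_move p v r :
    v <> 0 ->
    (forall k, (k < size G)%N -> ~ word_divides (Lw G`_k) (Lw v)) ->
    division G (p + << Lc v *g Lw v >>) (v - << Lc v *g Lw v >>) r ->
    division G p v r.

Definition normal_remainder G f r : Prop := division G 0 f r.

(** The data of o_{i,j}(w_i, w_i'; w_j, w_j'), with i = [ix1], j = [ix2],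
    w_i = [l1], w_i' = [r1], w_j = [l2], w_j' = [r2]. The generators are
    numbered from 0. For the non-trivial obstructions with i <= j, which are
    the ones stored by the procedure, the element [obs_elt] of the free
    bimodule determines these data. *)
Record obs := Obs {
  ix1 : nat; l1 : word; r1 : word;
  ix2 : nat; l2 : word; r2 : word
}.

Implicit Types (o q : obs) (N B : obs -> Prop).

(** The element of the free two-sided module attached to the data: the
    triple (i, (w, w')) stands for the K-basis vector w e_i w'. Indexing the
    canonical basis by [nat] accounts for all the modules F_s at once. *)
Definition obs_elt G o : {malg K[(nat * (word * word))%type]} :=
  (Lc G`_(ix1 o))^-1 *: << (ix1 o, (l1 o, r1 o)) >>
  - (Lc G`_(ix2 o))^-1 *: << (ix2 o, (l2 o, r2 o)) >>.

Definition is_obs G o : Prop :=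
  [/\ (ix1 o < size G)%N, (ix2 o < size G)%N,
      (l1 o * Lw G`_(ix1 o) * r1 o)%M = (l2 o * Lw G`_(ix2 o) * r2 o)%M
    & obs_elt G o <> 0].

Definition spoly G o : alg :=
  (Lc G`_(ix1 o))^-1 *: sandwich (l1 o) G`_(ix1 o) (r1 o)
  - (Lc G`_(ix2 o))^-1 *: sandwich (l2 o) G`_(ix2 o) (r2 o).

(** [k] is a letter position lying in both indicated occurrences. *)
Definition has_overlap G o : Prop :=
  exists k : nat,
    (size (l1 o) <= k < size (l1 o) + size (Lw G`_(ix1 o)))%N /\
    (size (l2 o) <= k < size (l2 o) + size (Lw G`_(ix2 o)))%N.

Definition nontrivial_form o : Prop :=
  if ix1 o == ix2 o
  then [/\ l1 o = 1%M, r2 o = 1%M, r1 o <> 1%M & l2 o <> 1%M]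
  else [\/ r1 o = 1%M /\ l2 o = 1%M, l1 o = 1%M /\ r2 o = 1%M,
           l2 o = 1%M /\ r2 o = 1%M | l1 o = 1%M /\ r1 o = 1%M].

Definition NTObs G (i j : nat) o : Prop :=
  [/\ ix1 o = i, ix2 o = j, is_obs G o, has_overlap G o & nontrivial_form o].

Definition multiple w u q : obs :=
  Obs (ix1 q) (w * l1 q)%M (r1 q * u)%M (ix2 q) (w * l2 q)%M (r2 q * u)%M.

Definition is_multiple G o q : Prop :=
  is_obs G o /\ exists w u, o = multiple w u q.

(** Step (4a), where [s] is the index of the last generator. *)
Definition NTObs_last G : obs -> Prop :=
  let s := (size G).-1 in
  fun o => exists i, (i <= s)%N /\ NTObs G i s o.

Definition removed_4b N o : Prop :=
  exists q, N q /\
  exists w u, [/\ l2 o = (w * l2 q)%M, r2 o = (r2 q * u)%M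
                & (w * u)%M <> 1%M].

Definition removed_4c N o : Prop :=
  exists q, N q /\
  exists w u, [/\ l2 o = (w * l2 q)%M, r2 o = (r2 q * u)%M
    & (ix1 q < ix1 o)%N \/
      [/\ ix1 o = ix1 q, (w * u)%M = 1%M, sigma (l1 q) (l1 o)
        & l1 q <> l1 o]].

Definition remove (R N : obs -> Prop) : obs -> Prop := fun o => N o /\ ~ R o.

Definition NTObs_reduced G : obs -> Prop :=
  let N := remove (removed_4b (NTObs_last G)) (NTObs_last G) in
  remove (removed_4c N) N.

Definition covered_4d G N o : Prop :=
  (is_obs G o /\ ~ has_overlap G o) \/ (exists q, N q /\ is_multiple G o q).

Definition removed_4d G N o : Prop :=
  let s := (size G).-1 in
  exists w u,
    [/\ (w * Lw G`_s * u)%M = (l2 o * Lw G`_(ix2 o) * r2 o)%M,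
        covered_4d G N (Obs (ix1 o) (l1 o) (r1 o) s w u)
      & covered_4d G N (Obs (ix2 o) (l2 o) (r2 o) s w u)].

(** The contents of the program variables G and B at the start of (B2). *)
Record state := State { gens : seq alg; pending : obs -> Prop }.

Implicit Types st : state.

Definition initial G : state :=
  State G (fun o => exists i j, (i <= j < size G)%N /\ NTObs G i j o).

Definition halted st : Prop := forall o, ~ pending st o.

Definition next st o r : state :=
  let B := remove (fun q => q = o) (pending st) in
  if r == 0 then State (gens st) B
  else
    let G := rcons (gens st) r in
    let N := NTObs_reduced G in
    State G (fun q => remove (removed_4d G N) B q \/ N q).

(** One passage through the loop with the obstruction [o] selected. *)
Definition step st o st' : Prop :=
  pending st o /\
  exists r, normal_remainder (gens st) (spoly (gens st) o) r /\
            st' = next st o r.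

Inductive reachable G : state -> Prop :=
| reachable_initial : reachable G (initial G)
| reachable_step st o st' :
    reachable G st -> step st o st' -> reachable G st'.

(** A run of the procedure; after the procedure has stopped the state is
    repeated for ever, so that finite runs are also indexed by [nat]. [sel m]
    is the obstruction selected in [run m], when there is one. *)
Definition execution G (run : nat -> state) (sel : nat -> obs) : Prop :=
  run 0%N = initial G /\
  forall m, (halted (run m) -> run m.+1 = run m) /\
            (~ halted (run m) -> step (run m) (sel m) (run m.+1)).

Definition fair (run : nat -> state) (sel : nat -> obs) : Prop :=
  forall m o, pending (run m) o ->
    exists k, (m <= k)%N /\ (sel k = o \/ ~ pending (run k) o).

End Procedure.

(* Main.v *)
Require Import Defs.
From mathcomp Require Import all_boot all_algebra finmap.
From mathcomp Require Import zify.
From Stdlib Require Import Classical.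

(** The S-polynomial of two occurrences w Lw(g) w' = u Lw(g') u' of leading
    words in a word W measures whether the normalised multiples w g w' and
    u g' u' are congruent modulo combinations of multiples of enumerated
    generators with leading word below W.  This congruence is an equivalence
    relation compatible with multiplication, and if any two occurrences in the
    same word are congruent, the generators form a Groebner basis.

    An obstruction that enters [B] gives a congruence: either it is selected,
    or step (4d) factors it through a new leading word dividing W.  The latter
    happens finitely often below a fixed word, because a new leading word is
    not divisible by the older ones.  The obstructions discarded in (4b) and
    (4c) are recovered when the generator g_s is appended, by induction on the
    length of W and, for pairs (i, s) in the same W, lexicographically on
    i, w_i and the length of u_s; the pairs (s, s) come last.

    If a finite Groebner basis exists, finitely many generators already
    account for its leading words; from then on all normal remainders vanish
    and the finite set [B] only loses elements. *)

Set Implicit Arguments.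
Unset Strict Implicit.
Unset Printing Implicit Defensive.

Import GRing.Theory.
Local Open Scope ring_scope.

Local Notation "1" := (@mone _) : monom_scope.
Local Notation "x * y" := (mmul x y) : monom_scope.

(** * Factorisations and divisibility of words *)

Section Words.
Variable X : finType.
Implicit Types a b c u v w : {fmonom X}.

Lemma fmonom_inj u v : u = v :> seq X -> u = v.
Proof. exact: val_inj. Qed.

Lemma size_fm1 : size (1%M : {fmonom X}) = 0%N.
Proof. by rewrite fm1. Qed.

Lemma size_fmM u v : size (u * v)%M = (size u + size v)%N.
Proof. by rewrite fmM size_cat. Qed.

Lemma size_fm_eq0 u : size u = 0%N -> u = 1%M.
Proof. exact: fdeg_eq0I. Qed.

Lemma size_fm_gt0 u : u <> 1%M -> (0 < size u)%N.
Proof. by move=> u1; rewrite lt0n; apply/eqP=> /size_fm_eq0. Qed.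

(** Levi's lemma: two factorisations of one word have a common refinement. The middle factor is what
    remains of [b] after its first [size a] letters. *)
Lemma fmM_levi a u b v : (a * u = b * v)%M -> (size a <= size b)%N ->
  exists c, b = (a * c)%M /\ u = (c * v)%M.
Proof.
move=> /(congr1 (@fmonom_val X)); rewrite !fmM => e ab.
exists (FMonom (drop (size a) b)).
have ea : a = take (size a) b :> seq X.
  by have := congr1 (take (size a)) e; rewrite take_size_cat // takel_cat.
have eu : u = drop (size a) b ++ v :> seq X.
  have := congr1 (drop (size a)) e; rewrite drop_size_cat // drop_cat.
  case: ltnP => // h; have -> : size a = size b by apply/eqP; rewrite eqn_leq ab.
  by rewrite subnn drop0 drop_size.
split; apply: fmonom_inj; rewrite fmM //=.
by rewrite [X in X ++ _]ea cat_take_drop.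
Qed.

Lemma fmMI a u v : (a * u = a * v)%M -> u = v.
Proof.
move=> /(congr1 (@fmonom_val X)); rewrite !fmM => e; apply: fmonom_inj.
by have := congr1 (drop (size a)) e; rewrite !drop_size_cat.
Qed.

Lemma fmIM b u v : (u * b = v * b)%M -> u = v.
Proof.
move=> /(congr1 (@fmonom_val X)); rewrite !fmM => e; apply: fmonom_inj.
have es : size u = size v.
  by have := congr1 size e; rewrite !size_cat => /eqP; rewrite eqn_add2r => /eqP.
by move/eqP: e; rewrite eqseq_cat // => /andP[/eqP].
Qed.

Lemma fmMIM a b u v : (a * u * b = a * v * b)%M -> u = v.
Proof. by move=> /fmIM /fmMI. Qed.

Lemma word_dividesP u w : reflect (word_divides u w) (infix u w).
Proof.
apply: (iffP (@infixP X u w)) => [[s [s' e]]|[a [b ->]]].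
  by exists (FMonom s), (FMonom s'); apply: fmonom_inj; rewrite !fmM -catA.
by exists a, b; rewrite !fmM -catA.
Qed.

Lemma word_divides_trans u v w :
  word_divides u v -> word_divides v w -> word_divides u w.
Proof.
by move=> /word_dividesP h1 /word_dividesP h2; apply/word_dividesP/(infix_trans h1).
Qed.

End Words.

(** * Consequences of the axioms of a word ordering *)

Section WordOrdering.
Variables (X : finType) (sigma : rel {fmonom X}).
Hypothesis Hsigma : word_ordering sigma.
Implicit Types a b c u v w W : {fmonom X}.

Definition wlt u v := sigma u v /\ u <> v.

Lemma wle_refl u : sigma u u.
Proof. by have := word_ordering_total Hsigma u u; rewrite orbb. Qed.

Lemma wle_trans u v w : sigma u v -> sigma v w -> sigma u w.
Proof. exact: (word_ordering_trans Hsigma). Qed.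

Lemma wle_anti u v : sigma u v -> sigma v u -> u = v.
Proof. by move=> h1 h2; apply: (word_ordering_anti Hsigma); rewrite h1 h2. Qed.

Lemma wle_lt_trans u v w : sigma u v -> wlt v w -> wlt u w.
Proof.
move=> h [h1 h2]; split; first exact: wle_trans h1.
by move=> e; apply: h2; apply: wle_anti => //; rewrite -e.
Qed.

Lemma wlt_trans u v w : wlt u v -> wlt v w -> wlt u w.
Proof. by move=> [h _]; apply: wle_lt_trans. Qed.

Lemma wle_eqVlt u v : sigma u v -> u = v \/ wlt u v.
Proof. by move=> h; case: (classic (u = v)) => e; [left|right]. Qed.

Lemma wleNgt u v : ~ sigma u v -> wlt v u.
Proof.
move=> h; have /orP[//|h2] := word_ordering_total Hsigma u v.
by split=> // e; apply: h; rewrite e wle_refl.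
Qed.

Lemma wle_mul a u v b : sigma u v -> sigma (a * u * b)%M (a * v * b)%M.
Proof. exact: (word_ordering_mul Hsigma). Qed.

Lemma wlt_mul a u v b : wlt u v -> wlt (a * u * b)%M (a * v * b)%M.
Proof. by move=> [h n]; split; [exact: wle_mul|move=> /fmMIM]. Qed.

Lemma wlt_ind (P : {fmonom X} -> Prop) :
  (forall w, (forall u, wlt u w -> P u) -> P w) -> forall w, P w.
Proof. exact: (well_founded_ind (word_ordering_wf Hsigma)). Qed.

(** A word [w] below the empty word would give [w * w] below [w], again below the empty word;
    well-foundedness forbids this descent. *)
Lemma wle1 w : sigma 1%M w.
Proof.
suff h : forall w, ~ wlt w 1%M.
  by have [//|] := boolP (sigma 1%M w) => /negP /wleNgt /h.
apply: wlt_ind => {}w IH hw.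
have h : wlt (w * w)%M w by have := wlt_mul w 1%M hw; rewrite !mulm1.
exact: IH h (wlt_trans h hw).
Qed.

End WordOrdering.

(** * Supports, leading words and two-sided multiples by words *)

Section LeadingWords.
Variables (K : fieldType) (X : finType) (sigma : rel {fmonom X}).
Hypothesis Hsigma : word_ordering sigma.
Local Notation word := {fmonom X}.
Local Notation alg := {malg K[{fmonom X}]}.
Local Notation Lw := (Lw sigma).
Local Notation Lc := (Lc sigma).
Local Notation wlt := (wlt sigma).
Implicit Types (f g h : alg) (a b u w W : word) (c : K).

Lemma msupp_wle_Lw f w : w \in msupp f -> sigma w (Lw f).
Proof.
rewrite /Defs.Lw -(mem_sort sigma); set s := sort _ _.
have /= := sort_sorted (word_ordering_total Hsigma) (msupp f); rewrite -/s.
rewrite (sorted_pairwise (word_ordering_trans Hsigma)).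
case: (lastP s) => [//|t x]; rewrite pairwise_rcons last_rcons mem_rcons inE.
by move=> /andP[/allP h _] /orP[/eqP->|/h //]; apply: wle_refl.
Qed.

Lemma Lw_in_msupp f : f <> 0 -> Lw f \in msupp f.
Proof.
move=> /eqP; rewrite -msupp_eq0 /Defs.Lw -(mem_sort sigma) => f0.
have : size (sort sigma (msupp f)) != 0%N.
  rewrite size_sort; apply: contraNN f0 => /nilP e.
  by apply/eqP/fsetP=> k; rewrite -[k \in msupp f]/(k \in (msupp f : seq _)) e.
by case: (sort _ _) => //= x s _; apply: mem_last.
Qed.

Lemma mcoeff_Lw f : f@_(Lw f) = Lc f.
Proof. by []. Qed.

Lemma Lc_neq0 f : f <> 0 -> Lc f != 0.
Proof. by move=> /Lw_in_msupp; rewrite -mcoeff_neq0. Qed.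

Lemma Lw_max f W : f@_W != 0 -> (forall w, w \in msupp f -> sigma w W) ->
  Lw f = W.
Proof.
rewrite mcoeff_neq0 => h1 h2; apply: (wle_anti Hsigma); last exact: msupp_wle_Lw.
by apply/h2/Lw_in_msupp => f0; move: h1; rewrite f0 msupp0.
Qed.

Lemma msuppB_in f g w : w \in msupp (f - g) -> w \in msupp f \/ w \in msupp g.
Proof.
by move/(fsubsetP (msuppB_le _ _)); rewrite in_fsetU => /orP.
Qed.

Lemma msuppD_in f g w : w \in msupp (f + g) -> w \in msupp f \/ w \in msupp g.
Proof.
by move/(fsubsetP (msuppD_le _ _)); rewrite in_fsetU => /orP.
Qed.

(** Cancellation at the top word [W]. S-polynomials, reduction steps and tails all get their strict
    bound from here. *)
Lemma msupp_cancel f g W :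
  (forall w, w \in msupp f -> sigma w W) ->
  (forall w, w \in msupp g -> sigma w W) -> f@_W = g@_W ->
  forall w, w \in msupp (f - g) -> wlt w W.
Proof.
move=> hf hg e w hw; split; first by case: (msuppB_in hw); auto.
by move=> ew; move: hw; rewrite ew -mcoeff_neq0 mcoeffB e subrr eqxx.
Qed.

Lemma malgUM c1 c2 u w :
  << c1 *g u >> * << c2 *g w >> = << c1 * c2 *g (u * w)%M >> :> alg.
Proof. by rewrite malgM_def fgmulUU. Qed.

Lemma sandwichE a f b :
  sandwich a f b = \sum_(k <- msupp f) << f@_k *g (a * k * b)%M >>.
Proof.
rewrite /sandwich {1}[f]monalgE mulr_sumr mulr_suml.
by apply: eq_bigr => k _; rewrite !malgUM mul1r mulr1.
Qed.

Lemma mcoeff_sandwich a f b w : (sandwich a f b)@_(a * w * b)%M = f@_w.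
Proof.
rewrite sandwichE {3}[f]monalgE !raddf_sum /=; apply: eq_bigr => k _.
rewrite !mcoeffU; congr (_ *+ nat_of_bool _).
by apply/eqP/eqP => [/fmMIM|->].
Qed.

Lemma msupp_sandwich a f b w : w \in msupp (sandwich a f b) ->
  exists2 k, k \in msupp f & w = (a * k * b)%M.
Proof.
rewrite -mcoeff_neq0 sandwichE raddf_sum /= => h.
apply: NNPP => n; move: h; rewrite big_seq big1 ?eqxx // => k hk.
rewrite mcoeffU; case: eqP => // e; case: n; exists k => //.
Qed.

Lemma sandwichD a f g b : sandwich a (f + g) b = sandwich a f b + sandwich a g b.
Proof. by rewrite /sandwich mulrDr mulrDl. Qed.

Lemma sandwichB a f g b : sandwich a (f - g) b = sandwich a f b - sandwich a g b.
Proof. by rewrite /sandwich mulrBr mulrBl. Qed.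

Lemma sandwich0 a b : sandwich a 0 b = 0 :> alg.
Proof. by rewrite /sandwich mulr0 mul0r. Qed.

(** Scalars are central: they sit on the empty word and [K] is commutative. *)
Lemma malg_scalerAr f c g : f * (c *: g) = c *: (f * g).
Proof.
rewrite -[c *: g]mul_malgC mulrA scalerAl; congr (_ * _).
rewrite malgM_def fgmulgU malgZ_def; apply: eq_bigr => k _.
by rewrite mulm1 mulrC.
Qed.

Lemma sandwichZ a c f b : sandwich a (c *: f) b = c *: sandwich a f b.
Proof. by rewrite /sandwich malg_scalerAr -scalerAl. Qed.

Lemma sandwichM a a' f b' b :
  sandwich a (sandwich a' f b') b = sandwich (a * a')%M f (b' * b)%M.
Proof.
have e : forall u w, << (u * w)%M >> = << u >> * << w >> :> alg.
  by move=> u w; rewrite malgUM mulr1.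
by rewrite /sandwich !e !mulrA.
Qed.

Lemma sandwich1 f : sandwich 1%M f 1%M = f.
Proof. by rewrite /sandwich -[<<1%M>>]/(1 : alg) mul1r mulr1. Qed.

Lemma msupp_sandwich_le a g b w :
  w \in msupp (sandwich a g b) -> sigma w (a * Lw g * b)%M.
Proof.
by move=> /msupp_sandwich [k hk ->]; apply: wle_mul => //; apply: msupp_wle_Lw.
Qed.

End LeadingWords.

(** The identity behind the product criterion. With [u] and [u'] the leading terms of [x *: g] and
    [y *: g'], the right-hand side involves only the tails, and the two products containing both [g]
    and [g'] cancel. *)
Lemma disjoint_spoly (K : comNzRingType) (A : lalgType K) (x y : K)
    (a b d g g' u u' : A) : (forall c (v w : A), v * (c *: w) = c *: (v * w)) ->
  x *: (a * g * (d * u' * b)) - y *: ((a * u * d) * g' * b) =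
  y *: (a * (x *: g - u) * d * g' * b) - x *: (a * g * (d * (y *: g' - u') * b)).
Proof.
move=> scAr; rewrite !(mulrBr, mulrBl, scalerBr, scAr, =^~ scalerAl, scalerA) !mulrA.
by rewrite [y * x]mulrC opprB [RHS]addrC addrA subrK.
Qed.

(** * Representations by multiples of generators, and congruence below a word *)

Section Representations.
Variables (K : fieldType) (X : finType) (sigma : rel {fmonom X}).
Hypothesis Hsigma : word_ordering sigma.
Local Notation word := {fmonom X}.
Local Notation alg := {malg K[{fmonom X}]}.
Local Notation Lw := (Lw sigma).
Local Notation Lc := (Lc sigma).
Local Notation wlt := (wlt sigma).
Implicit Types (f g h : alg) (a b u w W : word) (c : K).
Implicit Types (P : alg -> Prop) (Q : word -> Prop).

(** [Q] restricts the word [a * Lw g * b] of each summand, not the leading word of the sum, which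
    may be much smaller after cancellation. *)
Inductive rep P Q : alg -> Prop :=
| rep_zero : rep P Q 0
| rep_cons c a g b f : P g -> Q (a * Lw g * b)%M -> rep P Q f ->
    rep P Q (c *: sandwich a g b + f).

Lemma rep_mono P P' Q Q' f : (forall g, P g -> P' g) ->
  (forall w, Q w -> Q' w) -> rep P Q f -> rep P' Q' f.
Proof.
by move=> hP hQ; elim=> [|c a g b {}f h1 h2 _]; [exact: rep_zero|apply: rep_cons; auto].
Qed.

Lemma repD P Q f g : rep P Q f -> rep P Q g -> rep P Q (f + g).
Proof.
move=> hf hg; elim: hf => [|c a k b {}f h1 h2 _ IH]; first by rewrite add0r.
by rewrite -addrA; apply: rep_cons.
Qed.

Lemma rep_sandwich P Q Q' a b f : (forall w, Q w -> Q' (a * w * b)%M) ->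
  rep P Q f -> rep P Q' (sandwich a f b).
Proof.
move=> hQ; elim=> [|c a' k b' {}f h1 h2 _ IH]; first by rewrite sandwich0; apply: rep_zero.
rewrite sandwichD sandwichZ sandwichM; apply: rep_cons => //.
by have := hQ _ h2; rewrite !mulmA.
Qed.

Lemma repZ P Q c f : rep P Q f -> rep P Q (c *: f).
Proof.
elim=> [|c' a k b {}f h1 h2 _ IH]; first by rewrite scaler0; apply: rep_zero.
by rewrite scalerDr scalerA; apply: rep_cons.
Qed.

Lemma repN P Q f : rep P Q f -> rep P Q (- f).
Proof. by rewrite -scaleN1r; apply: repZ. Qed.

Lemma repB P Q f g : rep P Q f -> rep P Q g -> rep P Q (f - g).
Proof. by move=> hf hg; apply/repD/repN. Qed.

Lemma rep_sum P Q (r : seq word) (F : word -> alg) :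
  (forall k, k \in r -> rep P Q (F k)) -> rep P Q (\sum_(k <- r) F k).
Proof.
elim: r => [|k r IH] h; first by rewrite big_nil; apply: rep_zero.
rewrite big_cons; apply: repD; first by apply: h; rewrite inE eqxx.
by apply: IH => j hj; apply: h; rewrite inE hj orbT.
Qed.

Lemma rep1 P Q a g b : P g -> Q (a * Lw g * b)%M -> rep P Q (sandwich a g b).
Proof.
move=> h1 h2; rewrite -[sandwich _ _ _]scale1r -[X in rep _ _ X]addr0.
by apply: rep_cons => //; apply: rep_zero.
Qed.

Lemma rep_gen P Q g : P g -> Q (Lw g) -> rep P Q g.
Proof.
by move=> h1 h2; rewrite -[g]sandwich1; apply: rep1; rewrite // mul1m mulm1.
Qed.

Lemma rep_msupp P Q f w : (forall u v, sigma u v -> Q v -> Q u) ->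
  rep P Q f -> w \in msupp f -> Q w.
Proof.
move=> hQ; elim=> [|c a g b {}f h1 h2 _ IH]; first by rewrite msupp0.
case/msuppD_in => [|//] /(fsubsetP (msuppZ_le _ _)) /(msupp_sandwich_le Hsigma) h.
exact: hQ h h2.
Qed.

Lemma monalgZU (c : K) w : << c *g w >> = c *: << w >> :> alg.
Proof. by apply/malgP=> j; rewrite !mcoeffsE mulrnAr mulr1. Qed.

Lemma rep_mulr P Q a g t : P g ->
  (forall k, k \in msupp t -> Q (a * Lw g * k)%M) -> rep P Q (<< a >> * g * t).
Proof.
move=> Pg h; rewrite [t]monalgE mulr_sumr; apply: rep_sum => k hk.
by rewrite (monalgZU t@_k) malg_scalerAr; apply/repZ/rep1/h.
Qed.

Lemma rep_mull P Q t g b : P g ->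
  (forall k, k \in msupp t -> Q (k * Lw g * b)%M) -> rep P Q (t * g * << b >>).
Proof.
move=> Pg h; rewrite -mulrA {1}[t]monalgE mulr_suml; apply: rep_sum => k hk.
by rewrite (monalgZU t@_k) -scalerAl mulrA; apply/repZ/rep1/h.
Qed.

(** As the empty word is the least word, such a [g] is a non-zero constant, so each term of [f] is a
    multiple of [g] with the same word. This covers empty leading words, which never overlap
    anything. *)
Lemma rep_const P Q g f : P g -> g <> 0 -> Lw g = 1%M ->
  (forall w, w \in msupp f -> Q w) -> rep P Q f.
Proof.
move=> Pg g0 g1 h; have eg : g = Lc g *: 1.
  apply/malgP=> k; rewrite mcoeffZ mcoeff1 -mcoeff_Lw g1.
  case: eqP => [->|n]; first by rewrite mulr1.
  rewrite mulr0; apply/eqP; rewrite mcoeff_eq0; apply/negP => hk.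
  have := msupp_wle_Lw Hsigma hk; rewrite g1 => hk1.
  by apply: n; apply: (wle_anti Hsigma) hk1 _; apply: wle1.
have -> : f = (Lc g)^-1 *: (f * g * << 1%M >>).
  rewrite -[<<1%M>>]/(1 : alg) mulr1 {2}eg malg_scalerAr mulr1 scalerA.
  by rewrite mulVf ?scale1r // Lc_neq0.
by apply/repZ/rep_mull => // k hk; rewrite g1 !mulm1; apply: h.
Qed.

(** Locked: failed rewrites would otherwise compare two normalised multiples by
    unfolding the whole construction of the algebra. *)
Fact nf_key : unit. Proof. exact: tt. Qed.
Definition nf :=
  locked_with nf_key (fun a g b => (Lc g)^-1 *: sandwich a g b).

Lemma nfE a g b : nf a g b = (Lc g)^-1 *: sandwich a g b.
Proof. by rewrite /nf unlock. Qed.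

Lemma nf_sandwich u a g b w : sandwich u (nf a g b) w = nf (u * a)%M g (b * w)%M.
Proof. by rewrite !nfE sandwichZ sandwichM. Qed.

Lemma mcoeff_nf a g b : g <> 0 -> (nf a g b)@_(a * Lw g * b)%M = (1%R : K).
Proof.
by move=> /(Lc_neq0 sigma) h; rewrite nfE mcoeffZ mcoeff_sandwich mulVf.
Qed.

Lemma msupp_nf a g b w : w \in msupp (nf a g b) -> sigma w (a * Lw g * b)%M.
Proof.
by rewrite nfE => /(fsubsetP (msuppZ_le _ _)) /(msupp_sandwich_le Hsigma).
Qed.

Lemma msupp_nfB a g b a' g' b' w : g <> 0 -> g' <> 0 ->
  (a * Lw g * b = a' * Lw g' * b')%M ->
  w \in msupp (nf a g b - nf a' g' b') -> wlt w (a * Lw g * b)%M.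
Proof.
move=> g0 g'0 e; apply: msupp_cancel.
- by move=> {}w; apply: msupp_nf.
- by move=> {}w /msupp_nf; rewrite e.
by transitivity (1%R : K); [exact: mcoeff_nf|rewrite e; symmetry; exact: mcoeff_nf].
Qed.

Definition cong P W f g := rep P (fun w => wlt w W) (f - g).

Lemma cong_refl P W f : cong P W f f.
Proof. by rewrite /cong subrr; apply: rep_zero. Qed.

Lemma cong_sym P W f g : cong P W f g -> cong P W g f.
Proof. by move=> h; rewrite /cong -opprB; apply: repN. Qed.

Lemma cong_trans P W f g h : cong P W f g -> cong P W g h -> cong P W f h.
Proof. by move=> h1 h2; rewrite /cong -(subrK g f) -addrA; apply: repD. Qed.

Lemma cong_sandwich P W a f g b : cong P W f g ->
  cong P (a * W * b)%M (sandwich a f b) (sandwich a g b).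
Proof.
rewrite /cong -sandwichB; apply: rep_sandwich => w; exact: wlt_mul.
Qed.

Lemma cong_nf_sandwich P W u a g b a' g' b' w :
  cong P W (nf a g b) (nf a' g' b') ->
  cong P (u * W * w)%M (nf (u * a)%M g (b * w)%M) (nf (u * a')%M g' (b' * w)%M).
Proof. by move=> /(cong_sandwich u w); rewrite !nf_sandwich. Qed.

Definition tail g := (Lc g)^-1 *: g - << Lw g >>.

Lemma msupp_tail g w : g <> 0 -> w \in msupp (tail g) -> wlt w (Lw g).
Proof.
move=> g0; apply: msupp_cancel.
- by move=> {}w /(fsubsetP (msuppZ_le _ _)) /(msupp_wle_Lw Hsigma).
- by move=> {}w; rewrite msuppU1 inE => /eqP->; apply: wle_refl.
by rewrite mcoeffZ mcoeffUU mulVf // Lc_neq0.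
Qed.

(** Product criterion for two separated occurrences. The difference is a combination of products of
    one generator with the tail of the other; tails lie strictly below leading words, so each
    product lies strictly below the common word. *)
Lemma cong_nf_left P a g d g' b : P g -> P g' -> g <> 0 -> g' <> 0 ->
  cong P (a * Lw g * d * Lw g' * b)%M
    (nf a g (d * Lw g' * b)%M) (nf (a * Lw g * d)%M g' b).
Proof.
move=> Pg Pg' g0 g'0; rewrite /cong.
have e u w : << (u * w)%M >> = << u >> * << w >> :> alg by rewrite malgUM mulr1.
have -> : nf a g (d * Lw g' * b)%M - nf (a * Lw g * d)%M g' b =
   (Lc g')^-1 *: (<< a >> * tail g * << d >> * g' * << b >>)
   - (Lc g)^-1 *: (<< a >> * g * (<< d >> * tail g' * << b >>)).
  rewrite !nfE /sandwich !e; apply: (disjoint_spoly (A := alg)) => *; exact: malg_scalerAr.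
apply: repB; apply: repZ.
- apply: rep_mull => // k.
  move=> /msuppM_le [k1 [k2 [/msuppM_le [k3 [k4 [h3 h4 ->]]] h2 ->]]].
  move: h3 h2; rewrite !msuppU1 !inE => /eqP-> /eqP->.
  have := wlt_mul Hsigma a (d * Lw g' * b)%M (msupp_tail g0 h4).
  by rewrite !mulmA.
- apply: rep_mulr => // k.
  move=> /msuppM_le [k1 [k2 [/msuppM_le [k3 [k4 [h3 h4 ->]]] h2 ->]]].
  move: h3 h2; rewrite !msuppU1 !inE => /eqP-> /eqP->.
  have := wlt_mul Hsigma (a * Lw g * d)%M b (msupp_tail g'0 h4).
  by rewrite !mulmA.
Qed.

Lemma cong_nf_disjoint P a g b a' g' b' : P g -> P g' -> g <> 0 -> g' <> 0 ->
  (a * Lw g * b = a' * Lw g' * b')%M ->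
  ~ (exists k : nat, (size a <= k < size a + size (Lw g))%N /\
                     (size a' <= k < size a' + size (Lw g'))%N) ->
  cong P (a * Lw g * b)%M (nf a g b) (nf a' g' b').
Proof.
move=> Pg Pg' g0 g'0 e no.
have [g1|g1] := classic (Lw g = 1%M).
  apply: (@rep_const _ _ g) => // w; exact: msupp_nfB.
have [g1'|g1'] := classic (Lw g' = 1%M).
  apply: (@rep_const _ _ g') => // w; exact: msupp_nfB.
have s1 := size_fm_gt0 g1; have s2 := size_fm_gt0 g1'.
(* Non-empty occurrences without a shared position are separated: otherwise the later of the two
   starting positions would lie in both. *)
have [h|h] : (size a + size (Lw g) <= size a' \/ size a' + size (Lw g') <= size a)%N.
  have [] := leqP (size a + size (Lw g)) (size a') => h1; first by left.
  have [] := leqP (size a' + size (Lw g')) (size a) => h2; first by right.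
  case: no; exists (maxn (size a) (size a')); lia.
- have e1 : ((a * Lw g) * b = a' * (Lw g' * b'))%M by rewrite e mulmA.
  have [|c [ea eb]] := fmM_levi e1; first by rewrite size_fmM.
  by rewrite eb ea !mulmA; apply: cong_nf_left.
- have e1 : ((a' * Lw g') * b' = a * (Lw g * b))%M by rewrite -e mulmA.
  have [|c [ea eb]] := fmM_levi e1; first by rewrite size_fmM.
  by rewrite e; apply: cong_sym; rewrite eb ea !mulmA; apply: cong_nf_left.
Qed.

(** [P] may exceed [G]: the occurrences belong to the generators of one stage, while the
    representations may use generators appended later. *)
Definition occurrences_cong P (G : seq alg) := forall g g' a b a' b',
  g \in G -> g' \in G -> (a * Lw g * b = a' * Lw g' * b')%M ->
  cong P (a * Lw g * b)%M (nf a g b) (nf a' g' b').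

End Representations.

(** * The division algorithm *)

Section Division.
Variables (K : fieldType) (X : finType) (sigma : rel {fmonom X}).
Hypothesis Hsigma : word_ordering sigma.
Local Notation word := {fmonom X}.
Local Notation alg := {malg K[{fmonom X}]}.
Local Notation Lw := (Lw sigma).
Local Notation Lc := (Lc sigma).
Local Notation wlt := (wlt sigma).
Implicit Types (f g h p v r : alg) (a b u w W : word) (G : seq alg).

Lemma msupp_reduce v g a b w : g <> 0 -> Lw v = (a * Lw g * b)%M ->
  w \in msupp (v - (Lc v / Lc g) *: sandwich a g b) -> wlt w (Lw v).
Proof.
move=> g0 e; apply: (msupp_cancel (W := Lw v)).
- by move=> {}w; apply: msupp_wle_Lw.
- by move=> {}w /(fsubsetP (msuppZ_le _ _)) /(msupp_sandwich_le Hsigma); rewrite e.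
rewrite mcoeffZ e mcoeff_sandwich -e mcoeff_Lw divfK //; exact: Lc_neq0.
Qed.

Lemma msupp_move v w : w \in msupp (v - << Lc v *g Lw v >>) -> wlt w (Lw v).
Proof.
apply: msupp_cancel.
- by move=> {}w; apply: msupp_wle_Lw.
- move=> {}w /(fsubsetP msuppU_le); rewrite inE => /eqP->; exact: wle_refl.
by rewrite mcoeffUU.
Qed.

(** Both instructions strictly lower the leading word of [v], so well-founded induction on that word
    applies, for all [p] at once. *)
Lemma division_exists G p v : (forall g, g \in G -> g <> 0) ->
  exists r, division sigma G p v r.
Proof.
move=> G0; move: {2}(Lw v) (erefl (Lw v)) => W; elim/(wlt_ind Hsigma): W v p => W IH v p eW.
have {}IH v' p' : (forall w, w \in msupp v' -> wlt w W) -> exists r, division sigma G p' v' r.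
  move=> h; have [->|v'0] := classic (v' = 0); first by exists p'; apply: division_end.
  by apply: (IH (Lw v')) => //; apply/h/Lw_in_msupp.
have [->|v0] := classic (v = 0); first by exists p; apply: division_end.
pose div_at i := (i < size G)%N && infix (Lw G`_i) (Lw v).
have [ex|no] := classic (exists i, div_at i).
  (* The least index is taken, as [division_reduce] demands. *)
  have [i /andP[iG /word_dividesP [a [b e]]] imin] := ex_minnP ex.
  have [|r hr] := IH (v - (Lc v / Lc G`_i) *: sandwich a G`_i b) p.
    by rewrite -eW => w; apply: msupp_reduce => //; apply/G0/mem_nth.
  exists r; apply: division_reduce hr => // k ki /word_dividesP h.
  by have := imin k; rewrite /div_at (ltn_trans ki iG) h => /(_ isT); rewrite leqNgt ki.
have [|r hr] := IH (v - << Lc v *g Lw v >>) (p + << Lc v *g Lw v >>).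
  by rewrite -eW => w; apply: msupp_move.
exists r; apply: division_move hr => // k kG /word_dividesP h.
by apply: no; exists k; rewrite /div_at kG.
Qed.

Lemma division_undivisible G p v r : division sigma G p v r ->
  (forall w g, w \in msupp p -> g \in G -> ~ word_divides (Lw g) w) ->
  forall w g, w \in msupp r -> g \in G -> ~ word_divides (Lw g) w.
Proof.
elim=> // {}p {}v {}r v0 no _ IH h; apply: IH => w g /msuppD_in [|].
  exact: h.
move=> /(fsubsetP msuppU_le); rewrite inE => /eqP-> /(nthP 0) [i iG <-].
exact: no.
Qed.

(** The polynomial [v + p - r] is the sum of the multiples subtracted during the division. Leading
    words of [v] only decrease, so a downward closed [Q] is preserved throughout. *)
Lemma division_rep (Q : word -> Prop) G p v r :
  (forall g, g \in G -> g <> 0) -> (forall u w, sigma u w -> Q w -> Q u) ->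
  division sigma G p v r ->
  (forall w, w \in msupp v -> Q w) -> (forall w, w \in msupp p -> Q w) ->
  rep sigma (fun g => g \in G) Q (v + p - r) /\ (forall w, w \in msupp r -> Q w).
Proof.
move=> G0 hQ; elim=> {p v r} [p _ h|p v i a b r v0 iG e _ _ IH hv hp|p v r v0 _ _ IH hv hp].
- by rewrite add0r subrr; split=> //; apply: rep_zero.
- have Qv : Q (Lw v) by apply/hv/Lw_in_msupp.
  have GG : G`_i \in G by apply: mem_nth.
  have [|//|h1 h2] := IH.
    move=> w /(msupp_reduce (G0 _ GG) e) [h _]; exact: hQ Qv.
  split=> //; set c := _ / _ in h1.
  have -> : v + p - r = c *: sandwich a G`_i b + (v - c *: sandwich a G`_i b + p - r).
    by rewrite !addrA [_ + v]addrC addrK.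
  by apply: rep_cons => //; rewrite -e.
- have Qv : Q (Lw v) by apply/hv/Lw_in_msupp.
  have [||h1 h2] := IH.
  + move=> w /msupp_move [h _]; exact: hQ Qv.
  + move=> w /msuppD_in [/hp //|/(fsubsetP msuppU_le)]; rewrite inE => /eqP-> //.
  by split=> //; move: h1; rewrite [p + _]addrC addrA subrK.
Qed.

(** A non-zero remainder becomes a generator itself, so [f] is represented below [W] whether or not
    its remainder vanishes. *)
Lemma normal_remainder_cong (P : alg -> Prop) W G f r :
  (forall g, g \in G -> g <> 0) -> normal_remainder sigma G f r ->
  (forall w, w \in msupp f -> wlt w W) -> (forall g, g \in G -> P g) ->
  (r <> 0 -> P r) -> rep sigma P (fun w => wlt w W) f.
Proof.
move=> G0 hr hf GP Pr.
have [|//||h1 h2] := division_rep (Q := fun w => wlt w W) G0 _ hr.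
- by move=> u w; apply: wle_lt_trans.
- by move=> w; rewrite msupp0.
have -> : f = f + 0 - r + r by rewrite addr0 subrK.
apply: repD; first exact: rep_mono h1.
have [->|r0] := classic (r = 0); first exact: rep_zero.
by apply: rep_gen; [exact: Pr|exact/h2/Lw_in_msupp].
Qed.

Lemma normal_remainder_undivisible G f r : normal_remainder sigma G f r ->
  r <> 0 -> forall g, g \in G -> ~ word_divides (Lw g) (Lw r).
Proof.
move=> hr r0 g gG; apply: (division_undivisible hr) gG; last exact: Lw_in_msupp.
by move=> w k; rewrite msupp0.
Qed.

End Division.

(** * From congruent occurrences to Groebner bases *)

Section Criterion.
Variables (K : fieldType) (X : finType) (sigma : rel {fmonom X}).
Hypothesis Hsigma : word_ordering sigma.
Local Notation word := {fmonom X}.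
Local Notation alg := {malg K[{fmonom X}]}.
Local Notation Lw := (Lw sigma).
Local Notation Lc := (Lc sigma).
Local Notation wlt := (wlt sigma).
Local Notation rep := (rep sigma).
Local Notation cong := (cong sigma).
Local Notation nf := (nf sigma).
Implicit Types (f g h : alg) (a b u w W : word) (c : K).
Implicit Types (P I : alg -> Prop) (Q : word -> Prop).

Lemma rep_in_ideal P Q (J : alg -> Prop) f : two_sided_ideal J ->
  (forall g, P g -> J g) -> rep P Q f -> J f.
Proof.
move=> [J0 JD JM] PJ; elim=> [//|c a g b {}f Pg _ _ Jf].
apply: JD => //; rewrite -mul_malgC -[_ * sandwich _ _ _]mulr1.
by apply: (JM); apply: JM; apply: PJ.
Qed.

(** The representable polynomials form a two-sided ideal containing [P]; arbitrary factors are split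
    into their terms. *)
Lemma ideal_gen_rep P f : ideal_gen P f -> rep P (fun=> True) f.
Proof.
apply=> [|g Pg]; last exact: rep_gen.
split=> [|g h|a g b hg]; [exact: rep_zero|exact: repD|].
have hl : rep P (fun=> True) (a * g).
  rewrite [a]monalgE mulr_suml; apply: rep_sum => k _.
  rewrite (monalgZU a@_k) -scalerAl; apply: repZ.
  rewrite -[_ * g]mulr1; exact: (rep_sandwich (b := 1%M)) hg.
rewrite [b]monalgE mulr_sumr; apply: rep_sum => k _.
rewrite (monalgZU b@_k) malg_scalerAr; apply: repZ.
rewrite -[a * g]mul1r; exact: (rep_sandwich (a := 1%M)) hl.
Qed.

Lemma rep_max P Q f : rep P Q f ->
  f = 0 \/ exists W, Q W /\ rep P (fun w => sigma w W) f.
Proof.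
elim=> [|c a g b {}f Pg Qw _ IH]; first by left.
right; set w := (a * Lw g * b)%M in Qw *.
case: IH => [->|[W [QW hf]]].
  exists w; split=> //; apply: rep_cons => //; last exact: rep_zero.
  exact: wle_refl.
have /orP[h|h] := word_ordering_total Hsigma w W.
  by exists W; split=> //; apply: rep_cons.
exists w; split=> //; apply: rep_cons => //; first exact: wle_refl.
by apply: rep_mono hf => // u hu; apply: wle_trans hu h.
Qed.

Section Congruent.
Variable P : alg -> Prop.
Hypothesis P0 : forall g, P g -> g <> 0.
Hypothesis Pcong : forall g g' a b a' b', P g -> P g' ->
  (a * Lw g * b = a' * Lw g' * b')%M ->
  cong P (a * Lw g * b)%M (nf a g b) (nf a' g' b').

Lemma sandwich_nf a g b : P g -> sandwich a g b = Lc g *: nf a g b.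
Proof.
by move=> /P0 /(Lc_neq0 sigma) h; rewrite nfE scalerA mulfV ?scale1r.
Qed.

(** All summands sitting exactly at [W] are merged into a single one, since any two normalised
    multiples at [W] differ by something represented strictly below [W]. *)
Lemma rep_collect W f : rep P (fun w => sigma w W) f ->
  rep P (fun w => wlt w W) f \/
  exists a g b c h, [/\ P g, (a * Lw g * b)%M = W, rep P (fun w => wlt w W) h
                     & f = c *: nf a g b + h].
Proof.
elim=> [|c a g b {}f Pg]; first by left; apply: rep_zero.
move=> /wle_eqVlt [e _ IH|lt _ [IH|[a' [g' [b' [c' [h [Pg' e' hh ->]]]]]]]].
- right; case: IH => [hf|[a' [g' [b' [c' [h [Pg' e' hh ->]]]]]]].
    exists a, g, b, (c * Lc g), f; split; [by []|by []|by []|].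
    by rewrite (sandwich_nf _ _ Pg) scalerA.
  exists a, g, b, (c * Lc g + c'), (h - c' *: (nf a g b - nf a' g' b')).
  split; [by []|by []| |].
    by apply: repB => //; apply: repZ; rewrite -{1}e; apply: Pcong; rewrite ?e ?e'.
  rewrite (sandwich_nf _ _ Pg) scalerA scalerDl scalerBr opprB -addrA; congr (_ + _).
  by rewrite [RHS]addrC -addrA subrK addrC.
- by left; apply: rep_cons.
- right; exists a', g', b', c', (c *: sandwich a g b + h).
  by split; [by []|by []|apply: rep_cons|rewrite addrCA].
Qed.

(** Induction on the bound [W]. If the collected summand at [W] has coefficient zero, the bound can
    be lowered; otherwise nothing cancels it, and [W] is the leading word of [f]. *)
Lemma leading_word_divisible f : rep P (fun=> True) f -> f <> 0 ->
  exists2 g, P g & word_divides (Lw g) (Lw f).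
Proof.
move=> hf f0; have [//|[W [_ {hf}]]] := rep_max hf.
move: f0; elim/(wlt_ind Hsigma): W f => W IH f f0 hf.
have {}IH : rep P (fun w => wlt w W) f -> exists2 g, P g & word_divides (Lw g) (Lw f).
  by move=> /rep_max [//|[W' [ltW hW']]]; apply: IH ltW _ f0 hW'.
have [/IH //|[a [g [b [c [h [Pg e hh ef]]]]]]] := rep_collect hf.
have [c0|/eqP c0] := classic (c = 0); first by apply: IH; rewrite ef c0 scale0r add0r.
exists g => //; exists a, b; rewrite e; apply: (Lw_max Hsigma).
  rewrite ef mcoeffD mcoeffZ -{1}e mcoeff_nf; last exact: P0.
  rewrite mulr1 mcoeff_outdom ?addr0 //; apply/negP => hW.
  suff [_] : wlt W W by [].
  by apply: (rep_msupp Hsigma) hh hW => u v; apply: wle_lt_trans.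
by move=> w; apply: (rep_msupp Hsigma) hf => u v; apply: wle_trans.
Qed.

End Congruent.

Lemma groebner_of_divisible P I : (forall g, P g -> I g) ->
  (forall f, I f -> f <> 0 ->
     exists g, [/\ P g, g <> 0 & word_divides (Lw g) (Lw f)]) ->
  is_groebner_basis sigma P I.
Proof.
move=> PI h; split=> // k; split=> hk J HJ hJ; apply: hk => // _ [f [Pf f0 ->]].
  by apply: hJ; exists f; split; auto.
have [g [Pg g0 [a [b ->]]]] := h f Pf f0; case: HJ => _ _ JM.
have -> : << (a * Lw g * b)%M >> = << a >> * << Lw g >> * << b >> :> alg.
  by rewrite !malgUM !mulr1.
by apply: JM; apply: hJ; exists g.
Qed.

(** The polynomials all of whose words are divisible by leading words of [P] form an ideal [J]. It
    contains the ideal generated by these leading words, hence also [Lw f]. *)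
Lemma groebner_divisible P I f : is_groebner_basis sigma P I -> I f -> f <> 0 ->
  exists g, [/\ P g, g <> 0 & word_divides (Lw g) (Lw f)].
Proof.
move=> [_ /(_ << Lw f >>) [_ h]] If f0.
pose J (k : alg) := forall w, w \in msupp k ->
  exists g, [/\ P g, g <> 0 & word_divides (Lw g) w].
have /h/(_ J) hJ : ideal_gen (lead_words sigma I) << Lw f >>.
  by move=> J' _; apply; exists f.
apply: (hJ); last by rewrite msuppU1 inE.
  split=> [w|k k' hk hk' w /msuppD_in []|a k b hk w].
  - by rewrite msupp0.
  - exact: hk.
  - exact: hk'.
  move=> /msuppM_le [k1 [k2 [/msuppM_le [k3 [k4 [_ h4 ->]]] _ ->]]].
  have [g [Pg g0 hg]] := hk _ h4; exists g; split=> //.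
  by apply: word_divides_trans hg _; exists k3, k2.
move=> _ [g [Pg g0 ->]] w; rewrite msuppU1 inE => /eqP->.
by exists g; split=> //; exists 1%M, 1%M; rewrite mul1m mulm1.
Qed.

End Criterion.

(** * Reduction to non-trivial obstructions *)

Section Obstructions.
Variables (K : fieldType) (X : finType) (sigma : rel {fmonom X}).
Hypothesis Hsigma : word_ordering sigma.
Local Notation word := {fmonom X}.
Local Notation alg := {malg K[{fmonom X}]}.
Local Notation Lw := (Lw sigma).
Local Notation Lc := (Lc sigma).
Local Notation cong := (cong sigma).
Local Notation nf := (nf sigma).
Local Notation NTObs := (NTObs sigma).
Implicit Types (g : alg) (a b c d u v w W : word) (G : seq alg) (o q : obs X).
Implicit Types (P : alg -> Prop) (i j : nat).

Lemma common_prefix a x u y : (a * x = u * y)%M -> a <> 1%M -> u <> 1%M ->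
  exists c a' u', [/\ c <> 1%M, a = (c * a')%M & u = (c * u')%M].
Proof.
move=> e a1 u1; have [h|/ltnW h] := leqP (size a) (size u).
  by have [c [-> _]] := fmM_levi e h; exists a, 1%M, c; rewrite mulm1.
by have [c [-> _]] := fmM_levi (esym e) h; exists u, c, 1%M; rewrite mulm1.
Qed.

Lemma common_suffix b x v y : (x * b = y * v)%M -> b <> 1%M -> v <> 1%M ->
  exists c b' v', [/\ c <> 1%M, b = (b' * c)%M & v = (v' * c)%M].
Proof.
move=> e b1 v1; have [h|/ltnW h] := leqP (size x) (size y).
  by have [c [_ ->]] := fmM_levi e h; exists v, c, 1%M; rewrite mul1m.
by have [c [_ ->]] := fmM_levi (esym e) h; exists b, 1%M, c; rewrite mul1m.
Qed.

Definition oword G o := (l1 o * Lw G`_(ix1 o) * r1 o)%M.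

Definition ocong P G o :=
  cong P (oword G o) (nf (l1 o) G`_(ix1 o) (r1 o)) (nf (l2 o) G`_(ix2 o) (r2 o)).

Lemma spolyE G o : spoly sigma G o =
  nf (l1 o) G`_(ix1 o) (r1 o) - nf (l2 o) G`_(ix2 o) (r2 o).
Proof. by rewrite !nfE. Qed.

(** The two basis vectors are distinct, so the first one keeps its coefficient, the inverse of a
    leading coefficient. *)
Lemma obs_elt_neq0 G o : (forall g, g \in G -> g <> 0) -> (ix1 o < size G)%N ->
  (ix1 o, (l1 o, r1 o)) <> (ix2 o, (l2 o, r2 o)) -> obs_elt sigma G o <> 0.
Proof.
move=> G0 io /eqP ne e.
have h (T : choiceType) (c c' : K) (k k' : T) : k != k' ->
    (c *: << k >> - c' *: << k' >>)@_k = c.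
  move=> /negbTE nk; rewrite mcoeffB !mcoeffZ mcoeffUU mcoeffU eq_sym nk.
  by rewrite mulr0n mulr0 subr0 mulr1.
have := h _ (Lc G`_(ix1 o))^-1 (Lc G`_(ix2 o))^-1 _ _ ne.
rewrite -/(obs_elt sigma G o) e => /(etrans (esym (mcoeff0 _))) /esym /eqP.
by rewrite invr_eq0; apply/negP/(Lc_neq0 sigma)/G0/mem_nth.
Qed.

Section Pairs.
Variables (P : alg -> Prop) (G : seq alg).
Hypothesis G0 : forall g, g \in G -> g <> 0.
Hypothesis GP : forall g, g \in G -> P g.

Definition cong_below n := forall g g' a b u v, g \in G -> g' \in G ->
  (a * Lw g * b = u * Lw g' * v)%M -> (size (a * Lw g * b)%M < n)%N ->
  cong P (a * Lw g * b)%M (nf a g b) (nf u g' v).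

(** Two non-empty left (or right) cofactors share a non-empty prefix (or suffix). Removing it gives
    a shorter word, where the congruence is known, and multiplying back restores it. *)
Lemma cong_strip g g' a b u v : g \in G -> g' \in G ->
  (a * Lw g * b = u * Lw g' * v)%M -> cong_below (size (a * Lw g * b)%M) ->
  (a <> 1%M /\ u <> 1%M) \/ (b <> 1%M /\ v <> 1%M) ->
  cong P (a * Lw g * b)%M (nf a g b) (nf u g' v).
Proof.
move=> gG gG' e IH [[a1 u1]|[b1 v1]].
  have e1 : (a * (Lw g * b) = u * (Lw g' * v))%M by rewrite !mulmA.
  have [c [a' [u' [/size_fm_gt0 c1 ea eu]]]] := common_prefix e1 a1 u1.
  rewrite ea eu -!mulmA in e; have := fmMI e; rewrite !mulmA => {}e.
  have := cong_nf_sandwich Hsigma c 1%M (IH _ _ a' b u' v gG gG' e _).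
  rewrite !mulm1 ea eu !mulmA; apply.
  by rewrite !size_fmM; lia.
have [c [b' [v' [/size_fm_gt0 c1 eb ev]]]] := common_suffix e b1 v1.
rewrite eb ev !mulmA in e; have {}e := fmIM e.
have := cong_nf_sandwich Hsigma 1%M c (IH _ _ a b' u v' gG gG' e _).
rewrite !mul1m eb ev !mulmA; apply.
by rewrite !size_fmM; lia.
Qed.

Lemma reduce_to_overlap i j a b u v : (i < size G)%N -> (j < size G)%N ->
  (a * Lw G`_i * b = u * Lw G`_j * v)%M ->
  cong_below (size (a * Lw G`_i * b)%M) ->
  cong P (a * Lw G`_i * b)%M (nf a G`_i b) (nf u G`_j v) \/
  [/\ has_overlap sigma G (Obs i a b j u v), a = 1%M \/ u = 1%M & b = 1%M \/ v = 1%M].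
Proof.
move=> iG jG e IH; have gG := mem_nth 0 iG; have gG' := mem_nth 0 jG.
have [ov|no] := classic (has_overlap sigma G (Obs i a b j u v)); last first.
  by left; apply: (cong_nf_disjoint Hsigma); auto.
have [a1|a1] := classic (a = 1%M \/ u = 1%M); last first.
  by left; apply: cong_strip => //; left; split=> h; apply: a1; auto.
have [b1|b1] := classic (b = 1%M \/ v = 1%M); last first.
  by left; apply: cong_strip => //; right; split=> h; apply: b1; auto.
by right.
Qed.

Lemma cong_or_NTObs i j a b u v : (i < size G)%N -> (j < size G)%N -> i <> j ->
  (a * Lw G`_i * b = u * Lw G`_j * v)%M ->
  cong_below (size (a * Lw G`_i * b)%M) ->
  cong P (a * Lw G`_i * b)%M (nf a G`_i b) (nf u G`_j v) \/
  NTObs G i j (Obs i a b j u v).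
Proof.
move=> iG jG ij e IH; have [|[ov h1 h2]] := reduce_to_overlap iG jG e IH; first by left.
right; split=> //.
  by split=> //; apply: obs_elt_neq0 => //= -[].
(* One empty cofactor on each side: the four combinations are the four non-trivial forms. *)
by rewrite /nontrivial_form /=; case: eqP => // _; case: h1 h2 => [?|?] [?|?];
  [apply: Or44|apply: Or42|apply: Or41|apply: Or43].
Qed.

(** Occurrences of the same word have equal length, so neither can properly contain the other.
    Whichever starts first must be listed first, whence the two orders in the conclusion. *)
Lemma cong_or_NTObs_self i a b u v : (i < size G)%N ->
  (a * Lw G`_i * b = u * Lw G`_i * v)%M ->
  cong_below (size (a * Lw G`_i * b)%M) ->
  [\/ cong P (a * Lw G`_i * b)%M (nf a G`_i b) (nf u G`_i v),
      NTObs G i i (Obs i a b i u v) | NTObs G i i (Obs i u v i a b)].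
Proof.
move=> iG e IH.
have [eau|nau] := classic (a = u).
  rewrite -eau -!mulmA in e; have := fmMI (fmMI e) => ebv.
  by rewrite eau ebv; apply: Or31; apply: cong_refl.
have [|[ov h1 h2]] := reduce_to_overlap iG iG e IH; first by apply: Or31.
have ov' : has_overlap sigma G (Obs i u v i a b).
  by case: ov => k [hk1 hk2]; exists k.
have ne : (i, (a, b)) <> (i, (u, v)) by move=> -[].
have es := congr1 (fun w : word => size w) e; rewrite !size_fmM in es.
have bv1 : b <> 1%M \/ v <> 1%M.
  apply: NNPP => n; apply: nau.
  have b1 : b = 1%M by apply: NNPP => ?; apply: n; left.
  have v1 : v = 1%M by apply: NNPP => ?; apply: n; right.
  rewrite b1 v1 in e; exact: fmIM (fmIM e).
have self_obs a' b' u' v' : (i, (a', b')) <> (i, (u', v')) ->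
    (a' * Lw G`_i * b' = u' * Lw G`_i * v')%M ->
    has_overlap sigma G (Obs i a' b' i u' v') ->
    a' = 1%M -> v' = 1%M -> b' <> 1%M -> u' <> 1%M ->
    NTObs G i i (Obs i a' b' i u' v').
  move=> ne' e' ov1 a1 v1 b1 u1; split=> //; first by split=> //; apply: obs_elt_neq0.
  by rewrite /nontrivial_form /= eqxx.
case: h1 => [a1|u1].
- have u1 : u <> 1%M by rewrite a1 in nau; apply/nesym.
  have s1 := size_fm_gt0 u1; rewrite a1 size_fm1 in es.
  case: h2 => [b1|v1].
    by rewrite b1 size_fm1 in es; lia.
  apply: Or32; apply: self_obs => //.
  by case: bv1 => // h b1; rewrite b1 size_fm1 v1 in es; lia.
- have a1 : a <> 1%M by rewrite u1 in nau.
  have s1 := size_fm_gt0 a1; rewrite u1 size_fm1 in es.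
  case: h2 => [b1|v1]; last by rewrite v1 size_fm1 in es; lia.
  apply: Or33; apply: self_obs => //.
  - exact/nesym.
  - by case: bv1 => // h v1; rewrite b1 v1 size_fm1 in es; lia.
Qed.

Lemma nth_index_lt g : g \in G -> exists2 i, (i < size G)%N & G`_i = g.
Proof. by move=> /(nthP 0) [i h <-]; exists i. Qed.

Lemma occurrences_cong_of_below :
  (forall n, cong_below n -> forall i j a b u v, (i < size G)%N -> (j < size G)%N ->
     (a * Lw G`_i * b = u * Lw G`_j * v)%M -> size (a * Lw G`_i * b)%M = n ->
     cong P (a * Lw G`_i * b)%M (nf a G`_i b) (nf u G`_j v)) ->
  occurrences_cong sigma P G.
Proof.
move=> H; have below n : cong_below n.
  elim: n => [//|n IH] g g' a b u v gG gG' e.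
  rewrite ltnS leq_eqVlt => /orP[/eqP sz|lt]; last exact: IH.
  have [i iG eg] := nth_index_lt gG; have [j jG eg'] := nth_index_lt gG'.
  by rewrite -eg -eg'; apply: (H n); rewrite ?eg ?eg'.
move=> g g' a b u v gG gG' e; exact: (below _.+1) (leqnn _).
Qed.

(** Used for the initial generators, whose non-trivial obstructions all enter [B]. *)
Lemma occurrences_cong_all :
  (forall i j o, (i <= j)%N -> NTObs G i j o -> ocong P G o) ->
  occurrences_cong sigma P G.
Proof.
move=> H; apply: occurrences_cong_of_below => n IH i j a b u v iG jG e sz.
rewrite -sz in IH.
have IH' : cong_below (size (u * Lw G`_j * v)%M) by rewrite -e.
have [lt|lt|eij] := ltngtP i j.
- have nij : i <> j by move=> eij; rewrite eij ltnn in lt.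
  by have [//|/(H _ _ _ (ltnW lt))] := cong_or_NTObs iG jG nij e IH.
- have nij : j <> i by move=> eij; rewrite eij ltnn in lt.
  rewrite e; apply: cong_sym.
  by have [//|/(H _ _ _ (ltnW lt))] := cong_or_NTObs jG iG nij (esym e) IH'.
- subst j; have [//|/(H _ _ _ (leqnn _)) //|/(H _ _ _ (leqnn _)) h] :=
    cong_or_NTObs_self iG e IH.
  by rewrite e; apply: cong_sym.
Qed.

End Pairs.
End Obstructions.

(** * Appending a generator: recovering the obstructions removed in (4b) and (4c) *)

Section Extension.
Variables (K : fieldType) (X : finType) (sigma : rel {fmonom X}).
Hypothesis Hsigma : word_ordering sigma.
Local Notation word := {fmonom X}.
Local Notation alg := {malg K[{fmonom X}]}.
Local Notation Lw := (Lw sigma).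
Local Notation cong := (cong sigma).
Local Notation nf := (nf sigma).
Local Notation NTObs := (NTObs sigma).
Implicit Types (g : alg) (a b c d u v w W : word) (o q : obs X).
Implicit Types (i j : nat).

Variables (P : alg -> Prop) (G : seq alg) (r : alg).
Local Notation s := (size G).
Local Notation G' := (rcons G r).
Hypothesis G'0 : forall g, g \in G' -> g <> 0.
Hypothesis G'P : forall g, g \in G' -> P g.
Hypothesis Gcong : occurrences_cong sigma P G.
Hypothesis reduced_cong : forall o, NTObs_reduced sigma G' o -> ocong sigma P G' o.

Lemma NTObs_lastE o : NTObs_last sigma G' o <->
  exists2 j, (j <= s)%N & NTObs G' j s o.
Proof.
by rewrite /NTObs_last size_rcons; split=> [[j [h1 h2]]|[j h1 h2]]; exists j.
Qed.

Lemma cong_old i j a b u v : (i < s)%N -> (j < s)%N ->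
  (a * Lw G'`_i * b = u * Lw G'`_j * v)%M ->
  cong P (a * Lw G'`_i * b)%M (nf a G'`_i b) (nf u G'`_j v).
Proof. by move=> hi hj; rewrite !nth_rcons hi hj; apply: Gcong; apply: mem_nth. Qed.

Lemma NTObs_self_form o : NTObs G' s s o ->
  [/\ l1 o = 1%M, r2 o = 1%M, r1 o <> 1%M & l2 o <> 1%M].
Proof. by case=> e1 e2 _ _; rewrite /nontrivial_form e1 e2 eqxx. Qed.

Lemma NTObs_left_form i o : (i < s)%N -> NTObs G' i s o -> l2 o <> 1%M ->
  l1 o = 1%M.
Proof.
move=> lt [e1 e2 _ _]; rewrite /nontrivial_form e1 e2 (ltn_eqF lt).
by case=> -[].
Qed.

(** A removal provides a [q] with a multiple that has the same occurrence of the new leading word as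
    [o]. This [q] may have been removed too, so its congruence is not immediate and the inductions
    below are needed. *)
Lemma not_removed_cong o : NTObs_last sigma G' o ->
  [\/ ocong sigma P G' o, removed_4b (NTObs_last sigma G') o |
      exists q, NTObs_last sigma G' q /\ exists w w',
        [/\ l2 o = (w * l2 q)%M, r2 o = (r2 q * w')%M
          & (ix1 q < ix1 o)%N \/
            [/\ ix1 o = ix1 q, (w * w')%M = 1%M, sigma (l1 q) (l1 o)
              & l1 q <> l1 o]]].
Proof.
move=> oN.
have [|n4b] := classic (removed_4b (NTObs_last sigma G') o); first by apply: Or32.
set N := remove (removed_4b (NTObs_last sigma G')) (NTObs_last sigma G').
have [[q [[qN _] h]]|n4c] := classic (removed_4c sigma N o).
  by apply: Or33; exists q.
by apply/Or31/reduced_cong; split; [split|].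
Qed.

Section Word.
Variable n : nat.
Hypothesis below : cong_below sigma P G' n.

Lemma multiple_word j q w w' u v : NTObs G' j s q ->
  u = (w * l2 q)%M -> v = (r2 q * w')%M ->
  (w * l1 q * Lw G'`_j * (r1 q * w') = u * Lw G'`_s * v)%M.
Proof.
move=> [e1 e2 [_ _ eq _] _ _] -> ->; rewrite e1 e2 in eq.
by have := congr1 (fun x => (w * x * w')%M) eq; rewrite /= !mulmA.
Qed.

(** Settles the witness of (4b): the word of [q] is strictly shorter than [n], so [below] applies to
    [q] itself. *)
Lemma proper_multiple_cong j q w w' u v : NTObs G' j s q ->
  u = (w * l2 q)%M -> v = (r2 q * w')%M -> (w * w')%M <> 1%M ->
  size (u * Lw G'`_s * v)%M = n ->
  cong P (u * Lw G'`_s * v)%M (nf (w * l1 q)%M G'`_j (r1 q * w')%M)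
     (nf u G'`_s v).
Proof.
move=> hq eu ev /size_fm_gt0; rewrite size_fmM => ww sz.
rewrite -(multiple_word hq eu ev); rewrite -(multiple_word hq eu ev) in sz.
case: hq => e1 e2 [jG sG eq _] _ _; rewrite e1 e2 in eq jG sG.
have := cong_nf_sandwich Hsigma w w' (below (mem_nth 0 jG) (mem_nth 0 sG) eq _).
rewrite eu ev !mulmA; apply.
by rewrite -sz !size_fmM; set L := size (Lw _); lia.
Qed.

(** Let [q] be the witness of a removal. If its first generator is old, it suffices to compare the
    multiple of [q] with the new occurrence, because two old occurrences are congruent. For (4b)
    this is [proper_multiple_cong]; for (4c) either the index drops, or the index stays and [a]
    drops in the ordering. *)
Lemma cong_old_new i a b u v : (i < s)%N ->
  (a * Lw G'`_i * b = u * Lw G'`_s * v)%M ->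
  size (a * Lw G'`_i * b)%M = n ->
  cong P (a * Lw G'`_i * b)%M (nf a G'`_i b) (nf u G'`_s v).
Proof.
have sG' : (s < size G')%N by rewrite size_rcons.
move=> lt; move: {2}(size u) (erefl (size u)) => k.
elim/ltn_ind: i lt a k b u v => i IHi lt.
elim/(wlt_ind Hsigma) => a IHa; elim/ltn_ind => k IHk b u v su e sz.
have iG' : (i < size G')%N by rewrite size_rcons ltnS ltnW.
have nis : i <> s by move=> eis; rewrite eis ltnn in lt.
have below' : cong_below sigma P G' (size (a * Lw G'`_i * b)%M) by rewrite sz.
have [//|hN] := cong_or_NTObs Hsigma G'0 G'P iG' sG' nis e below'.
have sz' : size (u * Lw G'`_s * v)%M = n by rewrite -e.
have [//|[q [/NTObs_lastE [j js hq] [w [w' [/= eu ev ww1]]]]]|] :=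
  not_removed_cong (proj2 (NTObs_lastE _) (ex_intro2 _ _ i (ltnW lt) hN)).
  have c1 := proper_multiple_cong hq eu ev ww1 sz'.
  have e1 := multiple_word hq eu ev.
  rewrite e; apply: cong_trans c1; rewrite -e.
  move: js; rewrite leq_eqVlt => /orP[/eqP js|js]; last first.
    by apply: cong_old => //; rewrite e1.
  (* Here [q] pairs two occurrences of the new generator. If [b] is empty, the one further left is
     handled by induction on [size u]; otherwise both right cofactors are non-empty and a common
     suffix is stripped. *)
  subst j; have [lq rq rq1 lq1] := NTObs_self_form hq.
  have u1 : u <> 1%M by rewrite eu => /unitm [].
  have a1 : a = 1%M := NTObs_left_form lt hN u1.
  have [b1|b1] := classic (b = 1%M).
    apply: (IHk (size (w * l1 q)%M)) => //; last by rewrite e1.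
    by rewrite -su eu lq mulm1 size_fmM; have := size_fm_gt0 lq1; lia.
  apply: (cong_strip Hsigma); [exact: mem_nth|exact: mem_nth|by rewrite e1|by []|].
  by right; split=> // /unitm [].
move=> [q [/NTObs_lastE [j js hq] [w [w' [/= eu ev hj]]]]].
have e1 := multiple_word hq eu ev.
have [ej _ _ _ _] := hq; rewrite ej in hj.
have js' : (j < s)%N by case: hj => [h|[<- _ _ _]] //; apply: ltn_trans h lt.
have c1 : cong P (w * l1 q * Lw G'`_j * (r1 q * w'))%M
    (nf (w * l1 q)%M G'`_j (r1 q * w')%M) (nf u G'`_s v).
  case: hj => [ji|[eij /unitm [w1 w1'] h1 h2]].
    by apply: (IHi j) => //; rewrite e1.
  rewrite -eij in e1 *; apply: (IHa (w * l1 q)%M) => //; last by rewrite e1.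
  by rewrite w1 mul1m.
rewrite e1 in c1; rewrite e; apply: cong_trans c1; rewrite -e.
by apply: cong_old => //; rewrite e1.
Qed.

(** Pairs of an old and the new generator at length [n] are now available. If the witness [q] has an
    old first generator, its occurrence links the two occurrences of the new one ([via_old]). *)
Lemma cong_new_self o : NTObs G' s s o -> size (oword sigma G' o) = n ->
  ocong sigma P G' o.
Proof.
move=> oN; have [e1 e2 [_ _ e _] _ _] := oN; rewrite /ocong /oword e1 e2.
rewrite e1 e2 in e => sz.
have [a1 v1 b1 u1] := NTObs_self_form oN.
have sG' : (s < size G')%N by rewrite size_rcons.
have sz' : size (l2 o * Lw G'`_s * r2 o)%M = n by rewrite -e.
have via_old j q w w' : (j < s)%N -> NTObs G' j s q ->
    l2 o = (w * l2 q)%M -> r2 o = (r2 q * w')%M ->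
    cong P (l1 o * Lw G'`_s * r1 o)%M (nf (l1 o) G'`_s (r1 o))
      (nf (w * l1 q)%M G'`_j (r1 q * w')%M).
  move=> js hq eu ev; have e3 := multiple_word hq eu ev.
  rewrite e -e3; apply: cong_sym; apply: cong_old_new => //; first by rewrite e3.
  by rewrite e3.
have [|[q [/NTObs_lastE [j js hq] [w [w' [/= eu ev ww1]]]]]|] :=
  not_removed_cong (proj2 (NTObs_lastE _) (ex_intro2 _ _ s (leqnn _) oN)).
- by rewrite /ocong /oword e1 e2.
- have c1 := proper_multiple_cong hq eu ev ww1 sz'.
  rewrite -e in c1; apply: cong_trans c1.
  move: js; rewrite leq_eqVlt => /orP[/eqP js|js]; last exact: via_old hq eu ev.
  subst j; have [lq rq rq1 lq1] := NTObs_self_form hq.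
  have e3 := multiple_word hq eu ev.
  apply: (cong_strip Hsigma); [exact: mem_nth|exact: mem_nth|by rewrite e3|by rewrite sz|].
  by right; split=> // /unitm [].
move=> [q [/NTObs_lastE [j js hq] [w [w' [/= eu ev hj]]]]].
have e3 := multiple_word hq eu ev.
have [ej _ _ _ _] := hq; rewrite ej e1 in hj.
(* In a tie at the new index both first left cofactors are empty, whereas (4c) requires them to
   differ. *)
case: hj => [js'|[ejs _ _ h]]; last first.
  by rewrite -ejs in hq; have [lq _ _ _] := NTObs_self_form hq; case: h; rewrite lq a1.
apply: (cong_trans (via_old _ _ _ _ js' hq eu ev)).
rewrite e -e3; apply: cong_old_new => //; last by rewrite e3.
Qed.

End Word.

Lemma occurrences_cong_extend : occurrences_cong sigma P G'.
Proof.
have sG' : (s < size G')%N by rewrite size_rcons.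
apply: (occurrences_cong_of_below (P := P)) => n below i j a b u v.
have split_le k : (k < size G')%N -> k = s \/ (k < s)%N.
  by rewrite size_rcons ltnS leq_eqVlt => /orP[/eqP|]; [left|right].
move=> /split_le [->|hi] /split_le [->|hj] e sz.
- have below' : cong_below sigma P G' (size (a * Lw G'`_s * b)%M) by rewrite sz.
  have [//|h|h] := cong_or_NTObs_self Hsigma G'0 G'P sG' e below'.
    exact: (cong_new_self below h).
  by rewrite e; apply/cong_sym/(cong_new_self below h); rewrite /oword /= -e.
- rewrite e; apply: cong_sym; apply: (cong_old_new below hj (esym e)).
  by rewrite -e.
- exact: (cong_old_new below).
- exact: cong_old.
Qed.

End Extension.

(** * Generated two-sided ideals *)

Section Ideal.
Variable A : nzRingType.

Lemma ideal_gen_two_sided (P : A -> Prop) : two_sided_ideal (ideal_gen P).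
Proof.
split=> [J [J0 _ _] _ //|f g hf hg J HJ PJ|a f b hf J HJ PJ].
  by case: (HJ) => _ JD _; apply: JD; [exact: hf HJ PJ|exact: hg HJ PJ].
by case: (HJ) => _ _ JM; apply: JM; exact: hf HJ PJ.
Qed.

Lemma ideal_gen_sub (P : A -> Prop) g : P g -> ideal_gen P g.
Proof. by move=> Pg J _; apply. Qed.

End Ideal.

(** * Subwords of a word and strict decrease of counts *)

Section Subwords.
Variable T : eqType.

Definition subwords (w : seq T) : seq (seq T) :=
  [seq take l (drop p w) | p <- iota 0 (size w).+1, l <- iota 0 (size w).+1].

Lemma mem_subwords u w : infix u w -> u \in subwords w.
Proof.
move=> /infixP [x [y ->]]; apply/allpairsP; exists (size x, size u).
by split; rewrite ?mem_iota ?size_cat /fst /snd ?drop_size_cat ?take_size_cat //; lia.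
Qed.

Lemma count_lt (a a' : pred T) (l : seq T) x : (forall y, a' y -> a y) -> x \in l ->
  a x -> ~~ a' x -> (count a' l < count a l)%N.
Proof.
move=> sub xl ax nx; elim: l xl => //= y l IH.
have le : (a' y <= a y)%N by case: (boolP (a' y)) => // h; by rewrite sub.
have sub' : (count a' l <= count a l)%N by apply: sub_count.
rewrite inE => /orP[/eqP exy|/IH]; last by lia.
by move: ax nx; rewrite exy; case: (a y); case: (a' y) => // _ _; lia.
Qed.

End Subwords.

(** * Invariants of a run and the enumerated Groebner basis *)

Section Run.
Variables (K : fieldType) (X : finType) (sigma : rel {fmonom X}).
Hypothesis Hsigma : word_ordering sigma.
Local Notation word := {fmonom X}.
Local Notation alg := {malg K[{fmonom X}]}.
Local Notation Lw := (Lw sigma).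
Local Notation NTObs := (NTObs sigma).
Implicit Types (g : alg) (a b c d u v w W : word) (o q : obs X).
Implicit Types (i j k m n : nat) (G t : seq alg) (st : state K X).

Lemma NTObs_lt G i j o : NTObs G i j o -> (ix1 o < size G)%N /\ (ix2 o < size G)%N.
Proof. by case=> _ _ []. Qed.

Lemma NTObs_cat G t i j o : NTObs G i j o -> NTObs (G ++ t) i j o.
Proof.
move=> [e1 e2 [h1 h2 h3 h4] h5 h6]; split=> //; last first.
  by rewrite /has_overlap !nth_cat h1 h2.
by split; rewrite /obs_elt ?size_cat ?nth_cat ?h1 ?h2 //; apply: ltn_addr.
Qed.

Lemma oword_cat G t o : (ix1 o < size G)%N -> oword sigma (G ++ t) o = oword sigma G o.
Proof. by move=> h; rewrite /oword nth_cat h. Qed.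

Lemma ocong_cat P G t o : (ix1 o < size G)%N -> (ix2 o < size G)%N ->
  ocong sigma P (G ++ t) o = ocong sigma P G o.
Proof. by move=> h1 h2; rewrite /ocong /oword !nth_cat h1 h2. Qed.

Variables (G : seq alg) (I : alg -> Prop).
Hypothesis G0 : forall g, g \in G -> g <> 0.
Hypothesis HI : forall f, I f <-> ideal_gen (fun g => g \in G) f.

Lemma I_two_sided : two_sided_ideal I.
Proof.
have [h0 hD hM] := ideal_gen_two_sided (fun g => g \in G).
split; first exact/HI.
- by move=> f g /HI hf /HI hg; apply/HI; apply: hD.
- by move=> a f b /HI hf; apply/HI; apply: hM.
Qed.

Lemma rep_I Q f : rep sigma I Q f -> I f.
Proof. exact: rep_in_ideal I_two_sided _. Qed.

Definition state_inv st := [/\ forall g, g \in gens st -> g <> 0,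
  forall g, g \in gens st -> I g
  & forall o, pending st o -> NTObs (gens st) (ix1 o) (ix2 o) o].

Lemma normal_remainder_I st o r : state_inv st -> pending st o ->
  normal_remainder sigma (gens st) (spoly sigma (gens st) o) r -> I r.
Proof.
move=> [gens0 gensI pnd] po hr; have [h1 h2] := NTObs_lt (pnd o po).
have [//|//|//|h3 _] := division_rep Hsigma (Q := fun=> True) gens0 _ hr.
apply: (@rep_I (fun=> True)).
have -> : r = spoly sigma (gens st) o - (spoly sigma (gens st) o + 0 - r).
  by rewrite addr0 opprB addrC subrK.
apply: repB; last by apply: rep_mono h3.
by rewrite spolyE !nfE; apply: repB; apply: repZ; apply: rep1 => //;
  apply/gensI/mem_nth.
Qed.

Lemma step_state_inv st o st' : state_inv st -> step sigma st o st' -> state_inv st'.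
Proof.
move=> inv [po [r [hr ->]]]; have := normal_remainder_I inv po hr.
case: inv => gens0 gensI pnd Ir.
rewrite /Defs.next; case: (r =P 0) => [_|r0] /=.
  by split; [exact: gens0|exact: gensI|move=> q /= [hq _]; apply: pnd].
split=> [g|g|q] /=.
- by rewrite mem_rcons inE => /orP[/eqP->|/gens0].
- by rewrite mem_rcons inE => /orP[/eqP->|/gensI //].
case=> [[[hq _] _]|]; first by rewrite -cats1; apply: NTObs_cat; apply: pnd.
by move=> [[[i [_ hN]] _] _]; case: (hN) => -> ->.
Qed.

Lemma reachable_inv st : reachable sigma G st -> state_inv st.
Proof.
elim=> [|{}st o st' _ inv hs]; last exact: step_state_inv hs.
split=> [//|g gG|o [i [j [_ hN]]]] /=; first by apply/HI; apply: ideal_gen_sub.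
by case: (hN) => -> ->.
Qed.

Lemma step_exists st o : reachable sigma G st -> pending st o ->
  exists st', step sigma st o st'.
Proof.
move=> /reachable_inv [gens0 _ _] po.
have [r hr] := division_exists Hsigma 0 (spoly sigma (gens st) o) gens0.
by exists (Defs.next sigma st o r); split=> //; exists r.
Qed.

Section Execution.
Variables (run : nat -> state K X) (sel : nat -> obs X).
Hypothesis Hrun : execution sigma G run sel.
Hypothesis Hfair : fair run sel.
Local Notation Gs m := (gens (run m)).

Definition enumerated g := exists m, g \in Gs m.

Lemma run_step m : run m.+1 = run m \/ step sigma (run m) (sel m) (run m.+1).
Proof.
have [_ /(_ m) [h1 h2]] := Hrun.
by have [/h1|/h2] := classic (halted (run m)); [left|right].
Qed.

Lemma run_inv m : state_inv (run m).
Proof.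
elim: m => [|m IH]; first by case: Hrun => -> _; apply/reachable_inv/reachable_initial.
by have [->|] := run_step m; [|exact: step_state_inv].
Qed.

Lemma gens_mono m k : (m <= k)%N -> exists t, Gs k = Gs m ++ t.
Proof.
move=> /subnK <-; elim: (k - m)%N => [|d [t IH]]; first by exists [::]; rewrite cats0.
have [->|[_ [r [_ ->]]]] := run_step (d + m); first by exists t.
rewrite /Defs.next; case: eqP => _ /=; first by exists t.
by exists (rcons t r); rewrite IH rcons_cat.
Qed.

Lemma enumerated_neq0 g : enumerated g -> g <> 0.
Proof. by move=> [m]; case: (run_inv m) => h _ _; apply: h. Qed.

(** The measure that bounds how often (4d) can replace obstructions whose words divide [W]. *)
Definition uncovered W m := count
  (fun u : seq X => ~~ has (fun g => infix (Lw g) u) (Gs m)) (subwords W).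

Lemma uncovered_mono W m k : (m <= k)%N -> (uncovered W k <= uncovered W m)%N.
Proof.
move=> /gens_mono [t e]; apply: sub_count => u; rewrite e has_cat negb_or.
by case/andP.
Qed.

Lemma uncovered_lt W m r : Gs m.+1 = rcons (Gs m) r -> word_divides (Lw r) W ->
  (forall g, g \in Gs m -> ~ word_divides (Lw g) (Lw r)) ->
  (uncovered W m.+1 < uncovered W m)%N.
Proof.
move=> e /word_dividesP rW no; apply: (@count_lt _ _ _ _ (Lw r : seq X)).
- by move=> u; rewrite e has_rcons negb_or => /andP[].
- exact: mem_subwords.
- by apply/hasPn => g /no h; apply/negP => /word_dividesP.
by rewrite e has_rcons infix_refl.
Qed.

(** Fairness speaks of some later stage; this locates the stage at which [o] is selected or
    disappears, where the reason can be read off. *)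
Lemma pending_leaves m o : pending (run m) o -> exists k,
  [/\ (m <= k)%N, pending (run k) o & sel k = o \/ ~ pending (run k.+1) o].
Proof.
move=> po; have [k [mk h]] := Hfair po; rewrite -(subnK mk) in h.
move: (k - m)%N h => d {k mk}; elim: d m po => [|d IH] m po.
  by rewrite add0n => -[h|//]; exists m; split; auto.
rewrite addSnnS => h; have [pS|npS] := classic (pending (run m.+1) o).
  have [k' [h1 h2 h3]] := IH _ pS h.
  by exists k'; split=> //; apply: ltnW.
by exists m; split; auto.
Qed.

(** Induction on [uncovered W]. The word of [o] need only divide [W], because (4d) leads to
    obstructions whose multiples, rather than themselves, live in the word of [o]. *)
Lemma pending_cong W n m o : (uncovered W m < n)%N -> pending (run m) o ->
  word_divides (oword sigma (Gs m) o) W -> ocong sigma enumerated (Gs m) o.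
Proof.
elim: n m o => // n IH m o; rewrite ltnS => hn po oW.
have [k [mk pk hk]] := pending_leaves po.
have [gens0 _ pnd] := run_inv m; have [h1 h2] := NTObs_lt (pnd o po).
have [t et] := gens_mono mk.
rewrite -(ocong_cat _ t h1 h2) -et.
rewrite -(oword_cat t h1) -et in oW.
have {}hn := leq_trans (uncovered_mono W mk) hn.
have [{}gens0 gensI {}pnd] := run_inv k.
have [i1 i2] := NTObs_lt (pnd o pk).
have [_ _ [_ _ eobs _] _ _] := pnd o pk.
have nh : ~ halted (run k) by move/(_ o).
have [_ /(_ k) [_ /(_ nh) [psel [r [hr ek]]]]] := Hrun.
have [es|nes] := classic (sel k = o).
  rewrite es in hr ek; rewrite /ocong /cong -spolyE.
  apply: (normal_remainder_cong Hsigma gens0 hr).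
  - move=> w; rewrite spolyE; apply: (msupp_nfB Hsigma) => //;
      by apply/gens0/mem_nth.
  - by move=> g gk; exists k.
  - move=> r0; exists k.+1; rewrite ek /Defs.next; case: eqP => // _ /=.
    by rewrite mem_rcons inE eqxx.
have {hk} npk : ~ pending (run k.+1) o by case: hk.
(* A zero remainder deletes only the selected obstruction, which is not [o]. *)
have r0 : r <> 0.
  by move=> r0; apply: npk; rewrite ek /Defs.next r0 eqxx /=; split=> // /esym.
have eG : Gs k.+1 = rcons (Gs k) r by rewrite ek /Defs.next; case: eqP.
have pN q : NTObs_reduced sigma (Gs k.+1) q -> pending (run k.+1) q.
  by rewrite eG ek /Defs.next; case: eqP => //= _; right.
have [w [u [ew c1 c2]]] :
    removed_4d sigma (Gs k.+1) (NTObs_reduced sigma (Gs k.+1)) o.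
  apply: NNPP => nr; rewrite eG in nr; apply: npk.
  rewrite ek /Defs.next; case: eqP => //= _; left; split=> //.
  by split=> // /esym.
have eS : (size (Gs k.+1)).-1 = size (Gs k) by rewrite eG size_rcons.
have eo : oword sigma (Gs k.+1) o = (l2 o * Lw (Gs k.+1)`_(ix2 o) * r2 o)%M.
  by rewrite /oword eG -cats1 !nth_cat i1 i2.
have eoW : word_divides (oword sigma (Gs k.+1) o) W by rewrite eG -cats1 oword_cat.
have rW : word_divides (Lw r) W.
  apply: word_divides_trans eoW; rewrite eo -ew eS eG nth_rcons ltnn eqxx.
  by exists w, u.
have lt := uncovered_lt eG rW (normal_remainder_undivisible hr r0).
have {}IH q : pending (run k.+1) q -> word_divides (oword sigma (Gs k.+1) q) W ->
    ocong sigma enumerated (Gs k.+1) q by apply: IH; apply: leq_trans lt hn.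
have [gens0' _ _] := run_inv k.+1.
(* Without overlap the product criterion applies; otherwise [p] is a multiple of some [q] now
   pending, and the measure has dropped. *)
have cov p : covered_4d sigma (Gs k.+1) (NTObs_reduced sigma (Gs k.+1)) p ->
    word_divides (oword sigma (Gs k.+1) p) W -> ocong sigma enumerated (Gs k.+1) p.
  case=> [[[p1 p2 ep _] no] _|[q [qN [_ [x [y ->]]]]]].
    have g1 := mem_nth 0 p1; have g2 := mem_nth 0 p2.
    by apply: (cong_nf_disjoint Hsigma) => //;
      [exists k.+1|exists k.+1|exact: gens0'|exact: gens0'].
  have exy : oword sigma (Gs k.+1) (multiple x y q) = (x * oword sigma (Gs k.+1) q * y)%M.
    by rewrite /oword /multiple /= !mulmA.
  rewrite exy => xW.
  have := cong_nf_sandwich Hsigma x y (IH q (pN _ qN) (word_divides_trans _ xW)).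
  by rewrite /ocong exy; apply; exists x, y.
rewrite -(ocong_cat _ [:: r] i1 i2) cats1 -eG.
(* Both occurrences of [o] are congruent to the occurrence of the new leading word. *)
apply: (cong_trans (cov _ c1 eoW)); apply: cong_sym.
have := cov _ c2; rewrite /ocong -/(oword sigma _ _).
have -> : oword sigma (Gs k.+1) (Obs (ix2 o) (l2 o) (r2 o) (size (Gs k.+1)).-1 w u) =
  oword sigma (Gs k.+1) o by rewrite eo.
by apply.
Qed.

Lemma pending_ocong m o : pending (run m) o -> ocong sigma enumerated (Gs m) o.
Proof.
move=> po; apply: (pending_cong (W := oword sigma (Gs m) o) (ltnSn _)) => //.
by exists 1%M, 1%M; rewrite mul1m mulm1.
Qed.

(** Induction over the stages: every obstruction that has entered [B] is congruent by
    [pending_ocong], and those discarded on entry are recovered by [occurrences_cong_extend]. *)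
Lemma gens_occurrences_cong m : occurrences_cong sigma enumerated (Gs m).
Proof.
elim: m => [|m IH].
  have e0 : run 0 = initial sigma G by case: Hrun.
  apply: (occurrences_cong_all Hsigma).
  - by case: (run_inv 0).
  - by move=> g; exists 0%N.
  move=> i j o ij hN; apply: pending_ocong; rewrite e0 in hN *; exists i, j.
  by split=> //; have [] := NTObs_lt hN; case: hN => -> -> _ _ _ _; rewrite ij.
have [->//|[po [r [hr ek]]]] := run_step m.
have [r0|r0] := classic (r = 0).
  by rewrite ek /Defs.next r0 eqxx.
have eG : Gs m.+1 = rcons (Gs m) r by rewrite ek /Defs.next; case: eqP.
rewrite eG; apply: (occurrences_cong_extend Hsigma) => //.
- by rewrite -eG; case: (run_inv m.+1).
- by rewrite -eG => g; exists m.+1.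
rewrite -eG => o hN; apply: pending_ocong; rewrite eG in hN.
by rewrite ek /Defs.next; case: eqP => //= _; right.
Qed.

Lemma enumerated_divides f : I f -> f <> 0 ->
  exists2 g, enumerated g & word_divides (Lw g) (Lw f).
Proof.
move=> /HI /(ideal_gen_rep sigma) hf; apply: (leading_word_divisible Hsigma) => //.
- exact: enumerated_neq0.
- move=> g g' a b a' b' [m gm] [m' gm'].
  have [t et] := gens_mono (leq_maxl m m'); have [t' et'] := gens_mono (leq_maxr m m').
  apply: (gens_occurrences_cong (m := maxn m m')).
  + by rewrite et mem_cat gm.
  + by rewrite et' mem_cat gm'.
apply: rep_mono hf => // g gG; exists 0%N; by case: Hrun => -> _.
Qed.

Lemma enumerated_groebner : is_groebner_basis sigma enumerated I.
Proof.
apply: groebner_of_divisible => [g [m gm]|f If f0].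
  by case: (run_inv m) => _ h _; apply: h.
have [g Eg gf] := enumerated_divides If f0.
by exists g; split=> //; apply: enumerated_neq0.
Qed.

End Execution.
End Run.

(** * Termination when a finite Groebner basis exists *)

Section Termination.
Variables (K : fieldType) (X : finType) (sigma : rel {fmonom X}).
Hypothesis Hsigma : word_ordering sigma.
Local Notation word := {fmonom X}.
Local Notation alg := {malg K[{fmonom X}]}.
Local Notation Lw := (Lw sigma).
Local Notation NTObs := (NTObs sigma).
Implicit Types (g : alg) (a b c d u v w W : word) (o q : obs X).
Implicit Types (i j k m n : nat) (st : state K X).

Definition words_upto n : seq word :=
  flatten [seq [seq FMonom (val t) | t <- enum {: k.-tuple X}] | k <- iota 0 n.+1].

Lemma mem_words_upto n w : (size w <= n)%N -> w \in words_upto n.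
Proof.
move=> h; apply/flatten_mapP; exists (size w); first by rewrite mem_iota ltnS.
apply/mapP; exists (in_tuple w); first by rewrite mem_enum.
exact: fmonom_inj.
Qed.

(** A tuple with decidable equality, so that obstructions can be listed and filtered. *)
Definition obs_data o := (ix1 o, l1 o, r1 o, (ix2 o, l2 o, r2 o)).

Lemma obs_data_inj : injective obs_data.
Proof. by case=> [????? ?] [????? ?] [-> -> -> -> -> ->]. Qed.

(** An overlap together with the empty cofactors of a non-trivial form bounds all four cofactors by
    the maximal length [N] of a leading word. *)
Lemma NTObs_finite (G : seq alg) :
  exists L : seq (nat * word * word * (nat * word * word)), forall o i j,
  NTObs G i j o -> obs_data o \in L.
Proof.
pose N := (\max_(i < size G) size (Lw G`_i))%N.
have le_N i : (i < size G)%N -> (size (Lw G`_i) <= N)%N.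
  by move=> h; apply: (leq_bigmax (Ordinal h)).
pose occs := [seq (x.1, x.2, y) | x <- [seq (i, a) | i <- iota 0 (size G),
  a <- words_upto N], y <- words_upto N].
exists [seq (x, y) | x <- occs, y <- occs] => o i j [_ _ [h1 h2 e _] [k [hk1 hk2]] hf].
have mem_occs i' a b : (i' < size G)%N -> (size a <= N)%N -> (size b <= N)%N ->
    (i', a, b) \in occs.
  move=> hi ha hb; apply/allpairsP; exists ((i', a), b); split=> //=.
    apply/allpairsP; exists (i', a); split=> //=; first by rewrite mem_iota.
    exact: mem_words_upto.
  exact: mem_words_upto.
have n1 := le_N _ h1; have n2 := le_N _ h2.
have := congr1 (fun w : word => size w) e; rewrite /= !size_fmM => es.
have [s1 s2 s3 s4] : [/\ size (l1 o) <= N, size (r1 o) <= N, size (l2 o) <= N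
    & size (r2 o) <= N]%N.
  move: hf; rewrite /nontrivial_form; set M1 := size (Lw _) in hk1 es n1.
  set M2 := size (Lw _) in hk2 es n2.
  case: (ix1 o == ix2 o) => [[e1 e2 _ _]|[[e1 e2]|[e1 e2]|[e1 e2]|[e1 e2]]];
    rewrite e1 e2 size_fm1 in hk1 hk2 es *; split; lia.
apply/allpairsP; exists ((ix1 o, l1 o, r1 o), (ix2 o, l2 o, r2 o)).
by split=> //; apply: mem_occs.
Qed.

Section Execution.
Variables (G : seq alg) (I : alg -> Prop).
Hypothesis G0 : forall g, g \in G -> g <> 0.
Hypothesis HI : forall f, I f <-> ideal_gen (fun g => g \in G) f.
Variables (run : nat -> state K X) (sel : nat -> obs X).
Hypothesis Hrun : execution sigma G run sel.
Hypothesis Hfair : fair run sel.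
Local Notation Gs m := (gens (run m)).

Lemma enumerated_finite (Q : seq alg) :
  (forall f, f \in Q -> f <> 0 -> I f) ->
  exists m, forall f, f \in Q -> f <> 0 ->
    exists2 g, g \in Gs m & word_divides (Lw g) (Lw f).
Proof.
elim: Q => [|f Q IH] QI; first by exists 0%N.
have [|m hm] := IH; first by move=> k kQ; apply: QI; rewrite inE kQ orbT.
have [f0|f0] := classic (f = 0).
  exists m => k; rewrite inE => /orP[/eqP->|]; [by move=> /(_ f0)|exact: hm].
have [g [m' gm'] gf] :=
  enumerated_divides Hsigma G0 HI Hrun Hfair (QI _ (mem_head _ _) f0) f0.
have [t et] := gens_mono Hrun (leq_maxl m m').
have [t' et'] := gens_mono Hrun (leq_maxr m m').
exists (maxn m m') => k; rewrite inE => /orP[/eqP->|kQ] k0.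
  by exists g; rewrite // et' mem_cat gm'.
by have [g' gg' h] := hm k kQ k0; exists g'; rewrite // et mem_cat gg'.
Qed.

Lemma groebner_mono m k : (m <= k)%N ->
  (forall f, I f -> f <> 0 -> exists2 g, g \in Gs m & word_divides (Lw g) (Lw f)) ->
  forall f, I f -> f <> 0 -> exists2 g, g \in Gs k & word_divides (Lw g) (Lw f).
Proof.
move=> /(gens_mono Hrun) [t ->] h f If f0; have [g gm gf] := h f If f0.
by exists g; rewrite // mem_cat gm.
Qed.

(** Remainders lie in [I] and are not divisible by any leading word in [Gs m], so they all vanish.
    Each further pass only deletes the selected obstruction, and the list [L] shrinks. *)
Lemma halts m (L : seq (nat * word * word * (nat * word * word))) :
  (forall f, I f -> f <> 0 -> exists2 g, g \in Gs m & word_divides (Lw g) (Lw f)) ->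
  (forall o, pending (run m) o -> obs_data o \in L) ->
  exists2 k, (m <= k)%N & halted (run k).
Proof.
move: {2}(size L) (leqnn (size L)) => n.
elim: n m L => [|n IH] m L; first case: L => // _ _ h; first by exists m => // o /h.
move=> sz hm hL; have [ha|nh] := classic (halted (run m)); first by exists m.
have [_ /(_ m) [_ /(_ nh) [psel [r [hr ek]]]]] := Hrun.
have r0 : r = 0.
  apply: NNPP => r0; have inv := run_inv Hsigma G0 HI Hrun m.
  have Ir := normal_remainder_I Hsigma HI inv psel hr.
  have [g gm] := hm r Ir r0; exact: (normal_remainder_undivisible hr r0 gm).
have eS : run m.+1 = State (Gs m) (remove (fun q => q = sel m) (pending (run m))).
  by rewrite ek /Defs.next r0 eqxx.
have [|||k mk hk] := IH m.+1 (filter (predC1 (obs_data (sel m))) L).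
- rewrite -ltnS; apply: leq_trans sz; rewrite size_filter.
  rewrite -(count_predC (pred1 (obs_data (sel m)))).
  by rewrite -[X in (X < _)%N]add0n ltn_add2r -has_count has_pred1 hL.
- by rewrite eS.
- rewrite eS => o [po ne]; rewrite mem_filter hL // andbT /=.
  by apply/eqP => /obs_data_inj.
by exists k => //; apply: ltnW.
Qed.

(** The leading words of [Q] are all covered at some stage [m], hence so are those of [I]; at that
    stage [B] is finite. *)
Lemma finite_groebner_halts (Q : seq alg) :
  is_groebner_basis sigma (fun g => g \in Q) I ->
  exists m, halted (run m) /\
    is_groebner_basis sigma (fun g => g \in Gs m) I.
Proof.
move=> gbQ; have [|m hm] := enumerated_finite (Q := Q).
  by case: gbQ => h _ f fQ _; apply: h.
have hI f : I f -> f <> 0 -> exists2 g, g \in Gs m & word_divides (Lw g) (Lw f).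
  move=> If f0; have [q [qQ q0 qf]] := groebner_divisible gbQ If f0.
  by have [g gm gq] := hm q qQ q0; exists g => //; apply: word_divides_trans qf.
have [L hL] := NTObs_finite (Gs m).
have [|k mk hk] := halts hI (L := L).
  by have [_ _ pnd] := run_inv Hsigma G0 HI Hrun m; move=> o /pnd /hL.
exists k; split=> //; have [gens0 gensI _] := run_inv Hsigma G0 HI Hrun k.
apply: groebner_of_divisible => // f If f0.
by have [g gk gf] := groebner_mono mk hI If f0; exists g; split=> //; apply: gens0.
Qed.

End Execution.
End Termination.

Theorem theorem3p16 (K : fieldType) (X : finType) (sigma : rel {fmonom X})
    (Hsigma : word_ordering sigma)
    (G : seq {malg K[{fmonom X}]}) (I : {malg K[{fmonom X}]} -> Prop)
    (HG1 : (1 <= size G)%N)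
    (HG0 : forall g, g \in G -> g <> 0)
    (HI : forall f, I f <-> ideal_gen (fun g => g \in G) f) :
  (* every instruction can be carried out *)
  (forall st o, reachable sigma G st -> pending st o ->
     exists st', step sigma st o st') /\
  (* a Groebner basis is enumerated *)
  (forall run sel, execution sigma G run sel -> fair run sel ->
     is_groebner_basis sigma (fun g => exists m, g \in gens (run m)) I) /\
  (* termination when there is a finite Groebner basis *)
  ((exists Q : seq {malg K[{fmonom X}]},
      is_groebner_basis sigma (fun g => g \in Q) I) ->
   forall run sel, execution sigma G run sel -> fair run sel ->
     exists m, halted (run m) /\
       is_groebner_basis sigma (fun g => g \in gens (run m)) I).

Proof.
split; [|split].
- by move=> st o; apply: (step_exists Hsigma HG0 HI).
- by move=> run sel; apply: (enumerated_groebner Hsigma HG0 HI).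
- by move=> [Q gbQ] run sel hrun hfair;
  apply: (finite_groebner_halts Hsigma HG0 HI hrun hfair gbQ).
Qed.
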